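(* Let $H(x,p)=\sigma(x)m(|p|)$ for $(x,p)\in\mathbf{T}^N\times\mathbf{R}^N$, where $\sigma:\mathbf{T}^N\to(0,\infty)$ is continuous, $m:[0,\infty)\to(0,1)$ is Lipschitz continuous and strictly increasing, and $m(r)\to1$ as $r\to\infty$. Then there exists a unique function $\bar{H}_\infty:\mathbf{R}^N\to\mathbf{R}$ such that, for any admissible approximating sequence $\{H_n\}_{n\in\mathbf{N}}$ of $H$ with effective Hamiltonians $\bar{H}_n$, the following conditions hold: $$\liminf_{n\to\infty}\inf_{P\in\overline{B(0,R)}}\bigl(\bar{H}_\infty(P)-\bar{H}_n(P)\bigr)\ge0\quad\text{for all }R>0,$$ $$\limsup_{n\to\infty}\sup_{P\in\mathbf{R}^N}\bigl(\bar{H}_\infty(P)-\bar{H}_n(P)\bigr)\le0.$$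
   Context: $\mathbf{T}^N=\mathbf{R}^N/\mathbf{Z}^N$; functions on $\mathbf{T}^N$ are identified with $\mathbf{Z}^N$-periodic functions on $\mathbf{R}^N$. $\mathrm{Lip}(\mathbf{T}^N)$ is the set of Lipschitz continuous functions on $\mathbf{T}^N$. $\overline{B(x,r)}$ is the closed ball of radius $r$ centered at $x$. Viscosity solutions: for continuous $F:\mathbf{T}^N\times\mathbf{R}^N\to\mathbf{R}$ and $u\in C(\mathbf{T}^N)$, let $D^+u(x)$ (resp. $D^-u(x)$) be the set of $D\phi(x)$ with $\phi\in C^1(\mathbf{T}^N)$ such that $u-\phi$ attains its maximum (resp. minimum) over $\mathbf{T}^N$ at $x$. $u$ is a subsolution (resp. supersolution) of $F(x,Du)=0$ in $\mathbf{T}^N$ if $F(\hat x,p)\le0$ for all $\hat x$ and $p\in D^+u(\hat x)$ (resp. $F(\hat x,p)\ge0$ for all $\hat x$ and $p\in D^-u(\hat x)$); it is a solution if it is both. The equation $G(x,Du+P)=a$ is understood with $F(x,p)=G(x,p+P)-a$. An admissible approximating sequence of $H$ is a sequence of functions $H_n:\mathbf{T}^N\times\mathbf{R}^N\to\mathbf{R}$, $n\in\mathbf{N}$, such that (A1) each $H_n$ is continuous; (A2) each $H_n$ is coercive: $\lim_{r\to\infty}\inf\{H_n(x,p)\mid x\in\mathbf{T}^N,\ |p|\ge r\}=+\infty$; (A3) $\liminf_{n\to\infty}\inf_{\mathbf{T}^N\times\overline{B(0,R)}}(H-H_n)\ge0$ for all $R>0$; (A4) $\limsup_{n\to\infty}\sup_{\mathbf{T}^N\times\mathbf{R}^N}(H-H_n)\le0$.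 By a known result of Lions, Papanicolaou and Varadhan, for a continuous coercive $H_n$ and each $P\in\mathbf{R}^N$ there is a unique constant, denoted $\bar{H}_n(P)$, for which there exists a viscosity solution $u_n\in\mathrm{Lip}(\mathbf{T}^N)$ of $H_n(x,Du_n(x)+P)=\bar{H}_n(P)$ in $\mathbf{T}^N$. The function $\bar{H}_n:\mathbf{R}^N\to\mathbf{R}$ is the effective Hamiltonian of $H_n$. *)

(* Defs.v *)
From mathcomp Require Import all_boot all_order all_algebra.
From mathcomp Require Import all_classical all_reals all_analysis.

Set Implicit Arguments.
Unset Strict Implicit.
Unset Printing Implicit Defensive.

Import Order.TTheory GRing.Theory Num.Theory.
Import numFieldNormedType.Exports.

Local Open Scope classical_set_scope.
Local Open Scope ring_scope.

(* The library norm on 'rV[R]_N is the sup norm, so the Euclidean norm has to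
   be introduced.  The topology, the notions of differentiability and of
   Lipschitz continuity do not depend on which of the two norms is used. *)
Definition enorm (R : realType) (N : nat) (p : 'rV[R]_N) : R :=
  Num.sqrt (\sum_(i < N) p 0 i ^+ 2).

(* A function on the torus T^N = R^N / Z^N is represented by a Z^N-periodic
   function on R^N; suprema, infima and extrema over T^N are then suprema,
   infima and extrema over R^N. *)
Definition Zperiodic (R : realType) (N : nat) (T : Type) (f : 'rV[R]_N -> T) :=
  forall (x : 'rV[R]_N) (k : 'rV[int]_N), f (x + map_mx intr k) = f x.

Definition grad (R : realType) (N : nat) (phi : 'rV[R]_N -> R)
    (x : 'rV[R]_N) : 'rV[R]_N :=
  \row_(i < N) 'D_(delta_mx 0 i) phi x.

Definition C1_torus (R : realType) (N : nat) (phi : 'rV[R]_N -> R) : Prop :=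
  [/\ Zperiodic phi, forall x, differentiable phi x & continuous (grad phi)].

Definition Lip_torus (R : realType) (N : nat) (u : 'rV[R]_N -> R) : Prop :=
  Zperiodic u /\ lipschitz u.

Definition superdiff (R : realType) (N : nat) (u : 'rV[R]_N -> R)
    (x : 'rV[R]_N) : set 'rV[R]_N :=
  [set p | exists phi, [/\ C1_torus phi,
    forall y, u y - phi y <= u x - phi x & grad phi x = p]].

Definition subdiff (R : realType) (N : nat) (u : 'rV[R]_N -> R)
    (x : 'rV[R]_N) : set 'rV[R]_N :=
  [set p | exists phi, [/\ C1_torus phi,
    forall y, u x - phi x <= u y - phi y & grad phi x = p]].

Definition viscosity_subsolution (R : realType) (N : nat)
    (F : 'rV[R]_N -> 'rV[R]_N -> R) (u : 'rV[R]_N -> R) : Prop :=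
  forall x p, superdiff u x p -> F x p <= 0.

Definition viscosity_supersolution (R : realType) (N : nat)
    (F : 'rV[R]_N -> 'rV[R]_N -> R) (u : 'rV[R]_N -> R) : Prop :=
  forall x p, subdiff u x p -> 0 <= F x p.

Definition viscosity_solution (R : realType) (N : nat)
    (F : 'rV[R]_N -> 'rV[R]_N -> R) (u : 'rV[R]_N -> R) : Prop :=
  viscosity_subsolution F u /\ viscosity_supersolution F u.

(* For continuous, coercive G the constant Gbar P is uniquely determined by
   this property (Lions, Papanicolaou and Varadhan), so that Gbar is the
   effective Hamiltonian of G. *)
Definition effective_hamiltonian (R : realType) (N : nat)
    (G : 'rV[R]_N -> 'rV[R]_N -> R) (Gbar : 'rV[R]_N -> R) : Prop :=
  forall P, exists u, Lip_torus u /\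
    viscosity_solution (fun x p => G x (p + P) - Gbar P) u.

Definition continuous_hamiltonian (R : realType) (N : nat)
    (G : 'rV[R]_N -> 'rV[R]_N -> R) : Prop :=
  continuous (fun z : 'rV[R]_N * 'rV[R]_N => G z.1 z.2).

Definition coercive (R : realType) (N : nat)
    (G : 'rV[R]_N -> 'rV[R]_N -> R) : Prop :=
  ereal_inf [set (G z.1 z.2)%:E | z in [set z | r <= enorm z.2]]
    @[r --> +oo%R] --> +oo%E.

(* The infima and suprema are taken in \bar R. *)
Definition admissible (R : realType) (N : nat)
    (H : 'rV[R]_N -> 'rV[R]_N -> R)
    (Hn : nat -> 'rV[R]_N -> 'rV[R]_N -> R) : Prop :=
  [/\ forall n, Zperiodic (Hn n) /\ continuous_hamiltonian (Hn n),
      forall n, coercive (Hn n),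
      forall r : R, 0 < r ->
        (0 <= limn_einf (fun n => ereal_inf
           [set (H z.1 z.2 - Hn n z.1 z.2)%R%:E
              | z in [set z | (enorm z.2 <= r)%R]]))%E
    & (limn_esup (fun n => ereal_sup
         [set (H z.1 z.2 - Hn n z.1 z.2)%R%:E | z in setT]) <= 0)%E].

(* Main.v *)
Require Import Defs.
From mathcomp Require Import all_boot all_order all_algebra.
From mathcomp Require Import all_classical all_reals all_analysis.
From mathcomp Require Import ring lra.
Import Order.TTheory GRing.Theory Num.Theory.
Import numFieldNormedType.Exports.
Local Open Scope classical_set_scope.
Local Open Scope ring_scope.
Set Implicit Arguments.
Unset Strict Implicit.
Unset Printing Implicit Defensive.

(** The effective Hamiltonian of a coercive [G] at [P] is the least level [a] for which
    [G(x, Du + P) <= a] has a Lipschitz periodic subsolution, so [Hinf P] is defined as the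
    infimum of the same levels for [H] itself.
    - Upper estimate: a solution for [H_n] is, by (A4), a subsolution for [H] at level
      [Hbar_n(P) + o(1)], uniformly in [P].
    - Lower estimate: a nearly optimal subsolution for [H] is Lipschitz, hence its gradients stay
      in a ball, where (A3) makes it a subsolution for [H_n]; comparing it with the solution for
      [H_n] by doubling of variables bounds [Hbar_n(P)]. As [H] is Lipschitz in [p], one
      subsolution serves all [P] near a given one, and compactness gives uniformity in a ball.
    - Uniqueness: both estimates force [Hbar_n(P) -> Hinf(P)], so it is enough that one admissible
      sequence has effective Hamiltonians. This holds for [H_n = H + |p| / (n + 1)]: Perron's
      method, run among functions with a fixed Lipschitz constant, solves
      [l u + H_n(x, Du + P) = 0] for [l > 0], and a solution of the cell problem is obtained as
      [l] tends to 0 along an ultrafilter.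
    Since test functions have to be periodic, the usual quadratic penalty is replaced by
    [sum_i (1 - cos (2 pi (x_i - a_i)))]. *)

(** * Norms and Lipschitz functions *)

Section EuclideanNorm.
Context {R : realType} {N : nat}.
Implicit Types p q : 'rV[R]_N.

Lemma enorm_ge0 p : 0 <= enorm p.
Proof. exact: sqrtr_ge0. Qed.

Lemma enorm_sqr p : enorm p ^+ 2 = \sum_(i < N) p 0 i ^+ 2.
Proof. by rewrite sqr_sqrtr// sumr_ge0// => i _; rewrite sqr_ge0. Qed.

(** Lagrange's identity: the right side minus the left is half the sum of the squares of the minors
    [p_i q_j - p_j q_i]. *)
Lemma cauchy_schwarz p q : (\sum_i p 0 i * q 0 i) ^+ 2 <= enorm p ^+ 2 * enorm q ^+ 2.
Proof.
rewrite !enorm_sqr [leLHS]expr2 !big_distrlr /=.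
suff : 0 <= \sum_i \sum_j (p 0 i * q 0 j - p 0 j * q 0 i) ^+ 2.
  set A := (X in 0 <= X) => A0; rewrite -subr_ge0 -sumrB.
  set B := (X in 0 <= X).
  have -> : B = 2^-1 * A; last by rewrite mulr_ge0// invr_ge0.
  have eA : A = \sum_i \sum_j (p 0 i ^+ 2 * q 0 j ^+ 2 - p 0 i * q 0 i * (p 0 j * q 0 j))
     + \sum_i \sum_j (p 0 j ^+ 2 * q 0 i ^+ 2 - p 0 i * q 0 i * (p 0 j * q 0 j)).
    rewrite -big_split/=; apply: eq_bigr => i _.
    by rewrite -big_split/=; apply: eq_bigr => j _; ring.
  have eB : B = \sum_i \sum_j (p 0 i ^+ 2 * q 0 j ^+ 2 - p 0 i * q 0 i * (p 0 j * q 0 j)).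
    by apply: eq_bigr => i _; rewrite sumrB.
  rewrite eA [X in _ + X]exchange_big/= eB.
  under [in X in _ + X]eq_bigr do under eq_bigr do rewrite [X in _ - X]mulrC.
  lra.
by apply: sumr_ge0 => i _; apply: sumr_ge0 => j _; rewrite sqr_ge0.
Qed.

Lemma enormD p q : enorm (p + q) <= enorm p + enorm q.
Proof.
rewrite -(@ler_pXn2r _ 2)// ?nnegrE ?addr_ge0 ?enorm_ge0//.
rewrite sqrrD !enorm_sqr.
have -> : \sum_(i < N) (p + q) 0 i ^+ 2 = \sum_(i < N) p 0 i ^+ 2 +
    (\sum_i p 0 i * q 0 i) *+ 2 + \sum_(i < N) q 0 i ^+ 2.
  rewrite -sumrMnl -!big_split/=; apply: eq_bigr => i _.
  by rewrite mxE sqrrD.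
rewrite lerD2r lerD2l lerMn2r orFb.
apply: (le_trans (ler_norm _)).
rewrite -(@ler_pXn2r _ 2)// ?nnegrE ?mulr_ge0 ?enorm_ge0//.
by rewrite real_normK ?num_real// exprMn cauchy_schwarz.
Qed.

Lemma enormN p : enorm (- p) = enorm p.
Proof. by congr Num.sqrt; apply: eq_bigr => i _; rewrite mxE sqrrN. Qed.

Lemma ler_enorm_dist p q : `|enorm p - enorm q| <= enorm (p - q).
Proof.
have D (a b : 'rV[R]_N) : enorm a - enorm b <= enorm (a - b).
  by rewrite lerBlDr; have := enormD (a - b) b; rewrite subrK.
by rewrite ler_norml D andbT lerNl opprB -(enormN (p - q)) opprB D.
Qed.

Lemma coord_enorm p i : `|p 0 i| <= enorm p.
Proof.
rewrite -(@ler_pXn2r _ 2)// ?nnegrE ?enorm_ge0//.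
rewrite real_normK ?num_real// enorm_sqr (bigD1 i)//= lerDl.
by rewrite sumr_ge0// => j _; rewrite sqr_ge0.
Qed.

Lemma coord_mx_norm p i : `|p 0 i| <= `|p|.
Proof. by rewrite [leRHS]/Num.Def.normr/= mx_normrE; apply/bigmax_geP; right; exists (0, i). Qed.

Lemma enorm_le_coord p c : 0 <= c -> (forall i, `|p 0 i| <= c) -> enorm p <= N%:R * c.
Proof.
move=> c0 pc; rewrite -(@ler_pXn2r _ 2)// ?nnegrE ?mulr_ge0 ?enorm_ge0//.
rewrite enorm_sqr; apply: (@le_trans _ _ (\sum_(i < N) c ^+ 2)).
  apply: ler_sum => i _; rewrite -(real_normK (num_real (p 0 i))).
  by rewrite ler_pXn2r// nnegrE.
rewrite sumr_const card_ord exprMn -[leLHS]mulr_natl ler_wpM2r ?sqr_ge0//.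
by rewrite -natrX ler_nat; case: N => // n; rewrite expnS expn1 leq_pmulr.
Qed.

Lemma enorm_le_norm p : enorm p <= N%:R * `|p|.
Proof. by apply: enorm_le_coord => // i; exact: coord_mx_norm. Qed.

Lemma mx_norm_lt p c : 0 < c -> (forall i, `|p 0 i| < c) -> `|p| < c.
Proof.
move=> c0 pc; rewrite [ltLHS]/Num.Def.normr/= mx_normrE.
by apply/bigmax_ltP; split => // -[i j] _ /=; rewrite (ord1 i).
Qed.

Lemma mx_norm_le p c : 0 <= c -> (forall i, `|p 0 i| <= c) -> `|p| <= c.
Proof.
move=> c0 pc; rewrite [leLHS]/Num.Def.normr/= mx_normrE.
by apply/bigmax_leP; split => // -[i j] _ /=; rewrite (ord1 i).
Qed.

End EuclideanNorm.

Lemma continuous_dist_lt {R : numFieldType} (U W : normedModType R) (f : U -> W) (x : U) (e : R) : {for x, continuous f} -> 0 < e ->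
  exists2 d, 0 < d & forall y, `|y - x| < d -> `|f y - f x| < e.
Proof.
move=> fc e0; have /cvgrPdist_lt/(_ _ e0) := fc.
move=> /nbhs_ballP[d /= d0 dP]; exists d => // y yx.
by rewrite distrC; apply: dP; rewrite -ball_normE /ball_/= distrC.
Qed.

Section Lipschitz.
Context {R : realType} {U : normedModType R}.

Lemma dist_continuous (f : U -> R) L : (forall x y, `|f x - f y| <= L * `|x - y|) -> continuous f.
Proof.
move=> fL x; apply/cvgrPdist_lt => e e0.
near=> y; apply: (le_lt_trans (fL x y)).
(* [L] may be negative or zero; [|L| + 1] is a positive constant by which one can divide. *)
apply: (@le_lt_trans _ _ ((`|L| + 1) * `|x - y|)).
  by rewrite ler_wpM2r// (le_trans (ler_norm _))// lerDl.
rewrite -ltr_pdivlMl ?ltr_wpDl//.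
near: y; apply: cvgr_dist_lt; rewrite ?mulr_gt0 ?invr_gt0 ?ltr_wpDl//; exact: cvg_id.
Unshelve. all: by end_near. Qed.

Lemma lip_dist (f : U -> R) L : (forall x y, f x - f y <= L * `|x - y|) ->
  forall x y, `|f x - f y| <= L * `|x - y|.
Proof. by move=> fL x y; rewrite ler_norml fL andbT lerNl opprB distrC fL. Qed.

Lemma lip_continuous (f : U -> R) L : (forall x y, f x - f y <= L * `|x - y|) -> continuous f.
Proof. by move=> /lip_dist; exact: dist_continuous. Qed.

Lemma lipschitzP (f : U -> R) :
  lipschitz f <-> exists2 L, 0 <= L & forall x y, f x - f y <= L * `|x - y|.
Proof.
split=> [fl|[L L0 fL]].
  have [M [_ MP]] := fl.
  exists (`|M| + 1) => [|x y]; first by rewrite addr_ge0.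
  apply: le_trans (ler_norm _) _.
  by apply: (MP (`|M| + 1) _ (x, y)) => //; rewrite (le_lt_trans (ler_norm _))// ltrDl.
exists L; split; first exact: num_real.
move=> M LM [x y] _ /=; apply: (le_trans (lip_dist fL x y)).
by rewrite ler_wpM2r// ltW.
Qed.

End Lipschitz.

(** * Compactness of the torus *)

Section Torus.
Context {R : realType} {N : nat}.
Implicit Types x y a : 'rV[R]_N.

Lemma torus_representative x :
  exists k : 'rV[int]_N, `|x + map_mx intr k| <= 2^-1.
Proof.
(* Rounding to the nearest integer: [x_i - floor (x_i + 1/2)] lies in [[-1/2, 1/2)]. *)
exists (\row_i (- Num.floor (x 0 i + 2^-1))).
apply: mx_norm_le; first by rewrite invr_ge0.
move=> i; rewrite !mxE mulrNz.
have /andP[] := floor_itv (x 0 i + 2^-1); rewrite intrD mulr1z => *.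
rewrite ler_norml; apply/andP; split; lra.
Qed.

(** In the sup norm this is the closed unit cube centred at 0, a compact set that meets every orbit
    of [Z^N]. *)
Definition unit_cell : set 'rV[R]_N := [set x | `|x| <= 2^-1].

Lemma unit_cell0 : unit_cell 0.
Proof. by rewrite /unit_cell/= normr0 invr_ge0. Qed.

Lemma closed_norm_ball_compact (r : R) : compact [set x : 'rV[R]_N | `|x| <= r].
Proof.
apply: bounded_closed_compact.
  by exists r; split; [exact: num_real|move=> M rM x /= /le_trans; apply; exact: ltW].
apply: (@closed_comp _ _ _ [set s : R | s <= r]); last exact: closed_le.
by move=> x _; exact: norm_continuous.
Qed.

Lemma unit_cell_compact : compact unit_cell.
Proof. exact: closed_norm_ball_compact. Qed.

Lemma periodic_max (f : 'rV[R]_N -> R) : continuous f -> Zperiodic f ->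
  exists c, forall x, f x <= f c.
Proof.
move=> fc fp.
have [|c _ cmax] := @compact_EVT_max _ _ f _ (ex_intro _ _ unit_cell0) unit_cell_compact.
  exact: continuous_subspaceT.
exists c => x; have [k xk] := torus_representative x.
by rewrite -(fp x k); apply: cmax; rewrite inE.
Qed.

Lemma periodic_max2 (f : 'rV[R]_N * 'rV[R]_N -> R) : continuous f ->
  (forall x, Zperiodic (fun y => f (x, y))) ->
  (forall y, Zperiodic (fun x => f (x, y))) ->
  exists c, forall z, f z <= f c.
Proof.
move=> fc fp1 fp2.
have A0 : unit_cell `*` unit_cell !=set0 by exists (0, 0); split; exact: unit_cell0.
have [|c _ cmax] := compact_EVT_max A0 (compact_setX unit_cell_compact unit_cell_compact) (f := f).
  exact: continuous_subspaceT.
exists c => -[x y]; have [k xk] := torus_representative x.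
have [l yl] := torus_representative y.
by rewrite -(fp2 y x k) -(fp1 _ y l); apply: cmax; rewrite inE.
Qed.

(** Compactness of the cell is used as a covering property, with the increment [h] as a parameter
    near 0. A pair [x], [y] is then translated so that [y] falls into the cell. *)
Lemma periodic_unif_continuous (f : 'rV[R]_N -> R) e : continuous f -> Zperiodic f ->
  0 < e -> exists2 d, 0 < d & forall x y, `|x - y| < d -> `|f x - f y| < e.
Proof.
move=> fc fp e0.
have /compact_near_coveringP/(_ _ (nbhs (0 : 'rV[R]_N))
    (fun h x => `|f (x + h) - f x| < e) _) cov := unit_cell_compact.
have {cov} : \forall h \near (0 : 'rV[R]_N), unit_cell `<=` [set x | `|f (x + h) - f x| < e].
  apply: cov => x _.
  have fxe : \forall y \near x, `|f x - f y| < e / 2.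
    by apply: (@cvgr_dist_lt _ _ _ _ _ f (f x) (fc x)); rewrite divr_gt0.
  have : \forall y \near x & h \near (0 : 'rV[R]_N), `|f x - f (y + h)| < e / 2.
    have : (fun z : 'rV[R]_N * 'rV[R]_N => z.1 + z.2) z @[z --> (x, 0 : 'rV[R]_N)] --> x.
      by rewrite -[X in _ --> X]addr0; by apply: cvgD; [exact: cvg_fst|exact: cvg_snd].
    by move=> /(_ _ fxe).
  case=> [[A B]] /= [xA hB] AB; exists (A `&` [set y | `|f x - f y| < e / 2], B).
    by split => //=; exact: filterI.
  move=> [y h] /= [[Ay h2] Bh]; have /= h1 := AB (y, h) (conj Ay Bh).
  rewrite (_ : _ - _ = (f x - f y) - (f x - f (y + h))); last by ring.
  by rewrite (le_lt_trans (ler_normB _ _))// [ltRHS]splitr ltrD.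
move=> /nbhs_ballP[d /= d0 dP]; exists d => // x y xyd.
have [k yk] := torus_representative y.
have /= := dP (x - y) _ _ yk.
have -> : y + map_mx intr k + (x - y) = x + map_mx intr k by rewrite addrC addrA subrK.
rewrite !fp; apply.
by rewrite -ball_normE /ball_/= sub0r normrN.
Qed.

End Torus.

(** * Test functions *)

Section Gradient.
Context {R : realType} {N : nat}.
Implicit Types (x y a p : 'rV[R]_N) (f g phi psi : 'rV[R]_N -> R).

Lemma derive_line f x v : 'D_v f x = derive1 (fun h : R => f (h *: v + x)) 0.
Proof.
rewrite derive1E /derive; set g1 := fun h => h^-1 *: _; set g2 := fun h => h^-1 *: _.
suff -> : g1 = g2 by [].
apply/funext => h; rewrite /g1 /g2 /=.
by rewrite addr0 scale0r add0r [_%:A]mulr1.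
Qed.

(** The one-sided bound suffices because [h] takes both signs: right difference quotients are at
    least [- C], left ones at most [C]. *)
Lemma derive_bound f x v (C : R) : derivable f x v ->
  (forall h : R, f x - f (h *: v + x) <= C * `|h|) -> `|'D_v f x| <= C.
Proof.
move=> df fC.
have dcv : h^-1 *: (f (h *: v + x) - f x) @[h --> (0 : R)^'] --> 'D_v f x by exact: df.
rewrite ler_norml; apply/andP; split.
- apply: cvgr_to_ge (cvg_dnbhs_at_right dcv) _.
  near=> h; have h0 : 0 < h by near: h; exact: nbhs_right_gt.
  have := fC h; rewrite gtr0_norm// /GRing.scale/= => H.
  by rewrite ler_pdivlMl// mulrN lerNl opprB mulrC.
- apply: cvgr_to_le (cvg_dnbhs_at_left dcv) _.
  near=> h; have h0 : h < 0 by near: h; exact: nbhs_left_lt.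
  have := fC h; rewrite ltr0_norm// /GRing.scale/= => H.
  by rewrite ler_ndivrMl// -lerN2 opprB mulrC -mulrN.
Unshelve. all: by end_near. Qed.

Definition cosbump a x : R := \sum_(i < N) (1 - cos (pi *+ 2 * (x 0 i - a 0 i))).

Lemma cosbump_term_ge0 (t : R) : 0 <= 1 - cos t.
Proof. by rewrite subr_ge0 cos_le1. Qed.

Lemma cosbump_ge0 a x : 0 <= cosbump a x.
Proof. by apply: sumr_ge0 => i _; exact: cosbump_term_ge0. Qed.

Lemma cosbump_id a : cosbump a a = 0.
Proof. by apply: big1 => i _; rewrite subrr mulr0 cos0 subrr. Qed.

Lemma cosD2pi_nat (t : R) n : cos (t + pi *+ 2 * n%:R) = cos t.
Proof. by rewrite mulr_natr (periodicn (@cosD2pi R)). Qed.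

Lemma cosD2pi_int (t : R) (k : int) : cos (t + pi *+ 2 * k%:~R) = cos t.
Proof.
case: k => n; first exact: cosD2pi_nat.
rewrite NegzE mulrNz mulrN.
by rewrite -[in RHS](subrK (pi *+ 2 * n.+1%:R) t) cosD2pi_nat.
Qed.

Lemma cosbump_sym a x : cosbump a x = cosbump x a.
Proof. by apply: eq_bigr => i _; rewrite -cosN -mulrN opprB. Qed.

Lemma cosbump_periodic a : Zperiodic (cosbump a).
Proof.
move=> x k; apply: eq_bigr => i _; rewrite !mxE.
by rewrite addrAC mulrDr cosD2pi_int.
Qed.

(** The cosine is strictly decreasing on [[0, pi]], so a coordinate term below [1 - cos (2 pi r)]
    puts that coordinate difference within [r] of an integer. By periodicity, closeness can only
    hold up to an integer translation. *)
Lemma cosbump_small (r : R) : 0 < r -> exists2 c, 0 < c &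
  forall a x, cosbump a x < c -> exists k : 'rV[int]_N, `|x + map_mx intr k - a| < r.
Proof.
(* Radii up to 1/2 keep [2 pi r] inside [[0, pi]]. *)
wlog r1 : r / r <= 2^-1.
  move=> H r0; have [||c c0 cP] := H (Num.min r 2^-1).
  - by rewrite ge_min lexx orbT.
  - by rewrite lt_min r0 invr_gt0/=.
  exists c => // a x /cP[k]; rewrite lt_min => /andP[? _]; by exists k.
move=> r0; have pi2 : 0 < pi *+ 2 :> R by rewrite mulrn_wgt0 ?pi_gt0.
have in_0pi (s : R) : 0 <= s <= 2^-1 -> pi *+ 2 * s \in `[0, pi]%R.
  move=> /andP[s0 s2]; rewrite in_itv; change (is_true ((0 <= pi *+ 2 * s) && (pi *+ 2 * s <= pi))).
  apply/andP; split; first exact: mulr_ge0 (ltW pi2) s0.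
  by have := ler_wpM2l (ltW pi2) s2; rewrite -[X in _ <= X * _ -> _]mulr_natr mulfK.
exists (1 - cos (pi *+ 2 * r) : R).
  rewrite subr_gt0 -cos0 -(mulr0 (pi *+ 2)) ltr_cos ?in_0pi ?lexx ?invr_ge0 ?(ltW r0)//.
  by rewrite ltr_pM2l.
  by rewrite ler0n.
move=> a x bc; have [k xk] := torus_representative (x - a).
exists k; rewrite addrAC; apply: mx_norm_lt => // i.
set t : R := (x - a + map_mx intr k) 0 i.
have t2 : `|t| <= 2^-1 by apply: le_trans xk; exact: coord_mx_norm.
have : 1 - cos (pi *+ 2 * `|t|) < 1 - cos (pi *+ 2 * r).
  apply: le_lt_trans bc; rewrite /cosbump (bigD1 i)//=.
  have -> : cos (pi *+ 2 * `|t|) = cos (pi *+ 2 * (x 0 i - a 0 i)).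
    by rewrite -[X in X * `|t|](gtr0_norm pi2) -normrM cos_norm /t !mxE mulrDr cosD2pi_int.
  by rewrite lerDl sumr_ge0// => j _; exact: cosbump_term_ge0.
rewrite ltrD2l ltrN2 ltr_cos ?in_0pi ?normr_ge0 ?(ltW r0)//.
by rewrite ltr_pM2l.
Qed.

Lemma cosbump_term_derive (b t : R) :
  is_derive t 1 (fun s : R => 1 - cos (pi *+ 2 * (s - b))) (pi *+ 2 * sin (pi *+ 2 * (t - b))).
Proof.
have H : is_derive t 1 ((@cos R) \o (fun s : R => pi *+ 2 * (s - b)))
    (- sin (pi *+ 2 * (t - b)) * (pi *+ 2)).
  apply: is_derive1_comp.
  apply: is_derive_eq.
  by rewrite subr0 /GRing.scale/= mulr1.
have H1 := is_deriveB (is_derive_cst (1 : R) t 1) H.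
by apply: is_derive_eq H1 _; ring.
Qed.

Lemma cosbump_differentiable a x : differentiable (cosbump a) x.
Proof.
rewrite (_ : cosbump a = \sum_(i < N)
    ((fun s : R => 1 - cos (pi *+ 2 * (s - a 0 i))) \o (fun y : 'rV[R]_N => y 0 i : R))).
  apply: differentiable_sum => i; apply: differentiable_comp.
    exact: differentiable_coord.
  by apply/derivable1_diffP; case: (cosbump_term_derive (a 0 i) (x 0 i)).
by apply/funext => y; rewrite /cosbump fct_sumE.
Qed.

Lemma grad_cosbump a x : grad (cosbump a) x = \row_i (pi *+ 2 * sin (pi *+ 2 * (x 0 i - a 0 i))).
Proof.
apply/rowP => i; rewrite !mxE derive_line derive1E.
(* Along the line in direction [i] only the term of index [i] varies; [g] is that term, with [x_i]
   absorbed into the shift. *)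
pose g (s : R) := 1 - cos (pi *+ 2 * (s - (a 0 i - x 0 i))).
have -> : (fun h : R => cosbump a (h *: delta_mx 0 i + x)) =
    g + cst (\sum_(j < N | j != i) (1 - cos (pi *+ 2 * (x 0 j - a 0 j)))).
  apply/funext => h; rewrite /cosbump (bigD1 i)//= /g; congr (_ + _).
    by rewrite !mxE !eqxx/= mulr1 opprB addrA addrAC -addrA addrCA addrC -addrA.
  apply: eq_bigr => j ji; rewrite !mxE eqxx/= (negbTE ji) mulr0 add0r//.
have H : is_derive (0 : R) 1 (g + cst (\sum_(j < N | j != i) (1 - cos (pi *+ 2 * (x 0 j - a 0 j)))))
   (pi *+ 2 * sin (pi *+ 2 * (0 - (a 0 i - x 0 i))) + 0).
  by apply: is_deriveD; exact: cosbump_term_derive.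
by rewrite derive_val addr0 sub0r opprB.
Qed.

Lemma row_continuous (T : topologicalType) (g : T -> 'rV[R]_N) :
  (forall i, continuous (fun t => g t 0 i)) -> continuous g.
Proof.
move=> gc t; apply/cvgrPdist_lt => e e0.
have : \forall s \near t, forall i, `|g t 0 i - g s 0 i| < e.
  by apply: filter_forall => i; by have /cvgrPdist_lt/(_ _ e0) := gc i t.
apply: filterS => s H; apply: mx_norm_lt => // i.
by rewrite !mxE.
Qed.

Lemma C1_cosbump a : C1_torus (cosbump a).
Proof.
split; [exact: cosbump_periodic|by move=> x; exact: cosbump_differentiable|].
apply: row_continuous => i.
rewrite (_ : (fun t => _) = (fun x : 'rV[R]_N => pi *+ 2 * sin (pi *+ 2 * (x 0 i - a 0 i)))); last first.
  by apply/funext => x; rewrite grad_cosbump mxE.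
have sc : continuous (fun s : R => pi *+ 2 * sin (pi *+ 2 * (s - a 0 i))).
  move=> s; apply: cvgMl_tmp; apply: continuous_comp; last exact: continuous_sin.
  by apply: cvgMl_tmp; apply: cvgB; [exact: cvg_id|exact: cvg_cst].
by move=> x; apply: (continuous_comp (@coord_continuous _ _ _ 0 i x) (sc _)).
Qed.

Lemma gradD f g x : differentiable f x -> differentiable g x ->
  grad (f \+ g) x = grad f x + grad g x.
Proof. by move=> df dg; apply/rowP => i; rewrite !mxE deriveD//; exact: diff_derivable. Qed.

Lemma gradZ (c : R) f x : differentiable f x -> grad (c \*: f) x = c *: grad f x.
Proof. by move=> df; apply/rowP => i; rewrite !mxE deriveZ//; exact: diff_derivable. Qed.

Lemma grad_cst (c : R) x : grad (cst c) x = 0.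
Proof. by apply/rowP => i; rewrite !mxE derive_cst. Qed.

Lemma C1D f g : C1_torus f -> C1_torus g -> C1_torus (f \+ g).
Proof.
move=> [fp df fc] [gp dg gc]; split=> [x k|x|]; first by rewrite /= fp gp.
  exact: differentiableD.
rewrite (_ : grad _ = grad f \+ grad g); last by apply/funext => x; exact: gradD.
by move=> x; exact: (cvgD (fc x) (gc x)).
Qed.

Lemma C1Z (c : R) f : C1_torus f -> C1_torus (c \*: f).
Proof.
move=> [fp df fc]; split=> [x k|x|]; first by rewrite /= fp.
  exact: differentiableZ.
rewrite (_ : grad _ = c \*: grad f); last by apply/funext => x; exact: gradZ.
by move=> x; exact: (cvgZl_tmp (fc x)).
Qed.

Lemma C1_cst (c : R) : C1_torus (cst c : 'rV[R]_N -> R).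
Proof.
split=> //; rewrite (_ : grad _ = cst 0); last by apply/funext => x; exact: grad_cst.
exact: cst_continuous.
Qed.

Lemma C1_continuous f : C1_torus f -> continuous f.
Proof. by move=> [_ df _] x; exact: differentiable_continuous. Qed.

(** At a maximum of [f - phi], the decrease of [phi] away from [x] is at most that of [f], so
    [derive_bound] applies to [phi]. *)
Lemma superdiff_bound f (L : R) : (forall x y, f x - f y <= L * `|x - y|) ->
  forall x p, superdiff f x p -> forall i, `|p 0 i| <= L.
Proof.
move=> fL x p [phi [[_ dphi _] mx <-]] i; rewrite mxE; apply: derive_bound.
  exact: diff_derivable.
move=> h; have := mx (h *: delta_mx 0 i + x) => H.
have := fL x (h *: delta_mx 0 i + x); rewrite opprD addrCA subrr addr0 normrN normrZ.
have -> : `|delta_mx 0 i : 'rV[R]_N| = 1.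
  apply/eqP; rewrite eq_le mx_norm_le//=.
    by rewrite (le_trans _ (coord_mx_norm _ i))// mxE !eqxx normr1.
  by move=> j; rewrite mxE eqxx/=; case: (j == i); rewrite ?normr1 ?normr0.
by rewrite mulr1 => H2; lra.
Qed.

(** This is [derive_bound] with constant 0, applied to [g - f], which has a minimum at [x]. *)
Lemma grad_max_eq f g x : differentiable f x -> differentiable g x ->
  (forall y, f y - g y <= f x - g x) -> grad f x = grad g x.
Proof.
move=> df dg mx; apply/rowP => i; rewrite !mxE.
apply/eqP; rewrite -subr_eq0 -normr_le0 -deriveB; [|exact: diff_derivable..].
rewrite -normrN -deriveN; last by apply: derivableB; exact: diff_derivable.
apply: derive_bound.
  by apply: derivableN; apply: derivableB; exact: diff_derivable.
move=> h; rewrite mul0r /= !fctE.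
by have := mx (h *: delta_mx 0 i + x); lra.
Qed.

End Gradient.

(** * Stability of viscosity solutions *)

Section Stability.
Context {R : realType} {N : nat}.
Implicit Types (x y p : 'rV[R]_N) (u v phi : 'rV[R]_N -> R).
Implicit Types F : 'rV[R]_N -> R -> 'rV[R]_N -> R.

(** Here [F] may also depend on the value of [u], as the discounted equation requires. *)
Definition subsol F u := forall x p, superdiff u x p -> F x (u x) p <= 0.
Definition supersol F u := forall x p, subdiff u x p -> 0 <= F x (u x) p.

Lemma grad_periodic phi : Zperiodic phi -> Zperiodic (grad phi).
Proof.
move=> pp x k; apply/rowP => i; rewrite !mxE !derive_line.
by congr (derive1 _ 0); apply/funext => h; rewrite addrA pp.
Qed.

Lemma grad_cosbump_id x : grad (cosbump x) x = 0 :> 'rV[R]_N.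
Proof. by rewrite grad_cosbump; apply/rowP => i; rewrite !mxE subrr mulr0 sin0 mulr0. Qed.

(* The strict maximum of [u - phi - cosbump x0] at [x0] survives small perturbations of [u]. *)
Lemma superdiff_perturb u x0 phi r : C1_torus phi ->
  (forall y, u y - phi y <= u x0 - phi x0) -> 0 < r ->
  exists2 e, 0 < e & forall v, continuous v -> Zperiodic v ->
    (forall y, v y <= u y + e) -> u x0 - e <= v x0 ->
    exists y p, [/\ superdiff v y p, `|y - x0| < r, `|p - grad phi x0| < r & `|v y - u x0| < r].
Proof.
move=> phi1 mx r0; pose psi := phi \+ cosbump x0.
have psi1 : C1_torus psi := C1D phi1 (C1_cosbump x0).
have [phip dphi _] := phi1; have [psip dpsi cpsi] := psi1.
have gpsi : grad psi x0 = grad phi x0.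
  rewrite gradD//; last exact: cosbump_differentiable.
  by rewrite grad_cosbump_id addr0.
have [d1 d10 d1P] := continuous_dist_lt (cpsi x0) r0.
have r20 : 0 < r / 2 by rewrite divr_gt0.
have [d2 d20 d2P] := continuous_dist_lt (C1_continuous phi1 (x := x0)) r20.
pose d := Num.min r (Num.min d1 d2).
have d0 : 0 < d by rewrite !lt_min r0 d10 d20.
have [c c0 cP] := @cosbump_small _ N _ d0.
(* Comparing [v - psi] at its maximum point [y'] and at [x0] gives [cosbump x0 y' <= 2 e < c]. It
   also shows that [v y'] differs from [u x0] by at most [e] plus the variation of [phi], which is
   below [r / 2]. *)
exists (Num.min (c / 3) (r / 4)); first by rewrite lt_min !divr_gt0.
set e := Num.min _ _ => v vc vp vu uv.
have e1 : e <= c / 3 by rewrite ge_min lexx.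
have e2 : e <= r / 4 by rewrite ge_min lexx orbT.
have [||y' y'P] := @periodic_max _ _ (v \- psi).
- by move=> x; exact: (cvgB (vc x) (C1_continuous psi1 (x:=x))).
- by move=> x k /=; rewrite vp psip.
have Hx0 := y'P x0; have Hu := mx y'; have Hv := vu y'.
rewrite /psi/= cosbump_id in Hx0.
have [k kP] : exists k : 'rV[int]_N, `|y' + map_mx intr k - x0| < d by apply: cP; lra.
have b0 := cosbump_ge0 x0 y'.
move: kP; set y := y' + _; rewrite !lt_min => /and3P[yr yd1 yd2].
have eyb : cosbump x0 y = cosbump x0 y' by rewrite /y cosbump_periodic.
have eyv : v y = v y' by rewrite /y vp.
have eyp : phi y = phi y' by rewrite /y phip.
exists y, (grad psi y); split=> //.
- exists psi; split=> // z; apply: (le_trans (y'P z)).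
  by rewrite /y vp psip.
- by rewrite -gpsi; exact: d1P.
- by have := d2P _ yd2; rewrite !ltr_norml eyp eyv => /andP[? ?]; apply/andP; split; lra.
Qed.

(** If the test failed at [x0], [F] would stay above half its value there, while [superdiff_perturb]
    gives the approximant a nearby supergradient. The approximant has to be close to [u] from below
    only at [x0], which covers suprema of subsolutions as well as uniform limits. *)
Lemma subsol_stable F u :
  continuous (fun z : 'rV[R]_N * R * 'rV[R]_N => F z.1.1 z.1.2 z.2) ->
  (forall x0 (e : R), 0 < e -> exists v, [/\ continuous v, Zperiodic v,
     forall y, v y <= u y + e, u x0 - e <= v x0 & subsol (fun x s p => F x s p - e) v]) ->
  subsol F u.
Proof.
move=> Fc app x0 _ [phi [phi1 mx <-]]; rewrite leNgt; apply/negP => F0.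
have [r r0 rP] := continuous_dist_lt (Fc (x0, u x0, grad phi x0)) (divr_gt0 F0 (ltr0Sn _ 1)).
have [e e0 eP] := superdiff_perturb phi1 mx r0.
have e'0 : 0 < Num.min e (F x0 (u x0) (grad phi x0) / 2) by rewrite lt_min e0 divr_gt0.
have [v [vc vp vu uv vs]] := app x0 _ e'0.
have [||y [p [vyp yr pr vr]]] := eP v vc vp.
- by move=> y; apply: (le_trans (vu y)); rewrite lerD2l ge_min lexx.
- by apply: le_trans uv; rewrite lerD2l lerN2 ge_min lexx.
have := rP (y, v y, p); rewrite !prod_normE/= !gt_max yr vr pr => /(_ isT).
rewrite ltr_norml => /andP[H _].
have := vs _ _ vyp.
have : Num.min e (F x0 (u x0) (grad phi x0) / 2) <= F x0 (u x0) (grad phi x0) / 2.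
  by rewrite ge_min lexx orbT.
lra.
Qed.

Lemma subdiffN u x p : subdiff u x p -> superdiff (\- u) x (- p).
Proof.
move=> [phi [phi1 mn <-]]; exists (-1 \*: phi); split.
- exact: C1Z.
- by move=> y; have := mn y; rewrite /= /GRing.scale/=; lra.
- by have [_ dphi _] := phi1; rewrite gradZ// scaleN1r.
Qed.

Lemma superdiffN u x p : superdiff (\- u) x p -> subdiff u x (- p).
Proof.
move=> [phi [phi1 mx <-]]; exists (-1 \*: phi); split.
- exact: C1Z.
- by move=> y; have := mx y; rewrite /= /GRing.scale/=; lra.
- by have [_ dphi _] := phi1; rewrite gradZ// scaleN1r.
Qed.

(** The change of sign exchanges supersolutions and subsolutions, and so reduces stability of the
    former to that of the latter. *)
Lemma supersolN F u : subsol (fun x s p => - F x (- s) (- p)) (\- u) <-> supersol F u.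
Proof.
split=> H x p; last by move=> /superdiffN/H /=; rewrite opprK oppr_le0.
by move=> /subdiffN/H /=; rewrite !opprK oppr_le0.
Qed.

Lemma supersol_stable F u :
  continuous (fun z : 'rV[R]_N * R * 'rV[R]_N => F z.1.1 z.1.2 z.2) ->
  (forall x0 (e : R), 0 < e -> exists v, [/\ continuous v, Zperiodic v,
     forall y, u y - e <= v y, v x0 <= u x0 + e & supersol (fun x s p => F x s p + e) v]) ->
  supersol F u.
Proof.
move=> Fc app; apply/supersolN; apply: subsol_stable.
  pose T := ('rV[R]_N * R * 'rV[R]_N)%type.
  have c1 : continuous (fun z : T => z.1.1) by move=> z; exact: (cvg_comp _ _ cvg_fst cvg_fst).
  have c2 : continuous (fun z : T => - z.1.2).
    move=> z; apply: (@cvgN _ _ _ (nbhs z) _ (fun z : T => z.1.2)).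
    exact: (cvg_comp _ _ cvg_fst cvg_snd).
  have c3 : continuous (fun z : T => - z.2).
    by move=> z; apply: (@cvgN _ _ _ (nbhs z) _ (fun z : T => z.2)); exact: cvg_snd.
  have gc : continuous (fun z : T => (z.1.1, - z.1.2, - z.2)).
    by move=> z; exact: (cvg_pair (cvg_pair (c1 z) (c2 z)) (c3 z)).
  by move=> z; exact: (cvgN (continuous_comp (gc z) (Fc _))).
move=> x0 e e0; have [v [vc vp uv vu vs]] := app x0 e e0.
exists (\- v); split.
- by move=> x; exact: (cvgN (vc x)).
- by move=> x k /=; rewrite vp.
- by move=> y /=; have := uv y; lra.
- by rewrite /=; lra.
- have /supersolN := vs; move=> H x p /H; lra.
Qed.

End Stability.

(** * Perron's method *)

Section MaxLipschitz.
Context {R : realType} {N : nat}.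
Implicit Types (x y v : 'rV[R]_N) (u psi : 'rV[R]_N -> R).

Lemma derive_sum_coord psi x v : differentiable psi x ->
  'D_v psi x = \sum_(i < N) v 0 i * grad psi x 0 i.
Proof.
move=> dpsi; rewrite deriveE// {1}(row_sum_delta v) linear_sum.
by apply: eq_bigr => i _; rewrite linearZ/= mxE deriveE.
Qed.

Lemma is_derive_line psi x v t : differentiable psi (t *: v + x) ->
  is_derive t 1 (fun s : R => psi (s *: v + x)) ('D_v psi (t *: v + x)).
Proof.
move=> dpsi.
have dl := is_diffD (is_diff_scalel t v) (is_diff_cst x t).
have dl1 : differentiable (fun s : R => s *: v + x) t by case: dl => + _; exact.
have dl2 : 'd (fun s : R => s *: v + x) t = ( *:%R^~ v) + cst 0 :> (R -> _) by case: dl => _; exact.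
have d : differentiable (psi \o (fun s : R => s *: v + x)) t by exact: differentiable_comp.
apply: DeriveDef; first exact: diff_derivable.
by rewrite deriveE// diff_comp// /= dl2 !fctE addr0 scale1r -deriveE.
Qed.

(** Mean value theorem along the segment; the factor [N] comes from summing over the coordinates of
    the gradient. Only interior times are constrained, which is what is known before an exit
    point. *)
Lemma segment_bound psi x v (s L0 : R) : (forall z, differentiable psi z) -> 0 <= s ->
  (forall t, 0 < t < s -> forall i, `|grad psi (t *: v + x) 0 i| <= L0) ->
  psi x - psi (s *: v + x) <= N%:R * L0 * (s * `|v|).
Proof.
rewrite le_eqVlt => dpsi /predU1P[<-|s0] gb.
  by rewrite scale0r add0r subrr mul0r mulr0.
have [||c /itvP cs] := @MVT _ (fun t => psi (t *: v + x)) (fun t => 'D_v psi (t *: v + x)) 0 s s0.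
- by move=> t _; exact: is_derive_line.
- apply: derivable_within_continuous => t _.
  by case: (is_derive_line (dpsi (t *: v + x))).
rewrite scale0r add0r subr0 => H.
rewrite -opprB H -mulNr [leRHS]mulrCA mulrC ler_wpM2l ?(ltW s0)//.
apply: (le_trans (ler_norm _)); rewrite normrN derive_sum_coord//.
apply: (le_trans (ler_norm_sum _ _ _)).
apply: (@le_trans _ _ (\sum_(i < N) L0 * `|v|)); last first.
  by rewrite sumr_const card_ord -[leLHS]mulr_natl mulrA.
apply: ler_sum => i _; rewrite normrM mulrC ler_pM//; last exact: coord_mx_norm.
by apply: gb; rewrite !cs.
Qed.

(* Follow [psi] from [x] towards [y] as long as it exceeds [u]; from the exit point on, use
   the Lipschitz bound on [u]. *)
Lemma max_lipschitz u psi (L0 : R) : C1_torus psi ->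
  (forall x y, u x - u y <= N%:R * L0 * `|x - y|) ->
  (forall x, u x < psi x -> forall i, `|grad psi x 0 i| <= L0) ->
  forall x y, Num.max (u x) (psi x) - Num.max (u y) (psi y) <= N%:R * L0 * `|x - y|.
Proof.
move=> psi1 uL gL x y.
have uc := lip_continuous uL; have psic := C1_continuous psi1.
have dpsi : forall z, differentiable psi z by case: psi1.
have uy : u y <= Num.max (u y) (psi y) by rewrite le_max lexx.
have [ux|ux] := leP (psi x) (u x); first by have := uL x y; lra.
pose g (t : R) := t *: (y - x) + x.
have gc : continuous g.
  move=> t; apply: (@cvgD _ _ _ (nbhs t) _ (fun t => t *: (y - x)) (cst x)); last exact: cvg_cst.
  by apply: cvgZr_tmp; exact: cvg_id.
have g0 : g 0 = x by rewrite /g scale0r add0r.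
have g1 : g 1 = y by rewrite /g scale1r subrK.
pose A := `[0, 1] `&` [set t | psi (g t) <= u (g t)].
have cA : compact A.
  apply: (subclosed_compact _ (@segment_compact _ 0 1)); last by move=> t [].
  apply: closedI; first exact: itv_closed.
  rewrite (_ : [set t | _] = [set t | ((psi \o g) \- (u \o g)) t <= 0]); last first.
    by apply/seteqP; split=> t /=; rewrite subr_le0.
  apply: (@closed_comp _ _ ((psi \o g) \- (u \o g)) [set r : R | r <= 0]); last exact: closed_le.
  move=> t _; apply: (@cvgB _ _ _ (nbhs t) _ (psi \o g) (u \o g)).
    exact: (continuous_comp (gc t) (psic _)).
  exact: (continuous_comp (gc t) (uc _)).
have [A0|A0] := eqVneq A set0.
  have nA t : 0 <= t <= 1 -> u (g t) < psi (g t).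
    move=> t01; rewrite ltNge; apply/negP => H.
    by have : A t by []; rewrite A0.
  have := @segment_bound psi x (y - x) 1 L0 dpsi ler01.
  rewrite -/(g 1) g1 mul1r distrC => /(_ _)/wrap[|H].
    by move=> t /andP[t0 t1]; apply: gL; apply: nA; rewrite !ltW.
  have : psi y <= Num.max (u y) (psi y) by rewrite le_max lexx orbT.
  lra.
move/set0P : A0 => A0.
have [|s sA sP] := @compact_EVT_min _ _ (fun t : R => t) _ A0 cA.
  by apply: continuous_subspaceT => t; exact: cvg_id.
move: sA; rewrite inE => -[/=]; rewrite in_itv/= => /andP[s0 s1] sle.
have H1 : psi x - psi (g s) <= N%:R * L0 * (s * `|y - x|).
  apply: segment_bound => // t /andP[t0 ts]; apply: gL; rewrite ltNge; apply/negP => H.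
  have : A t by split => //=; rewrite in_itv/= (ltW t0) (le_trans (ltW ts)).
  by move=> At; have := sP t; rewrite inE => /(_ At); rewrite leNgt ts.
have H2 := uL (g s) y.
have e2 : `|g s - y| = (1 - s) * `|x - y|.
  rewrite (_ : g s - y = (1 - s) *: (x - y)) ?normrZ ?ger0_norm ?subr_ge0//.
  by apply/rowP => i; rewrite !mxE; ring.
rewrite e2 in H2; rewrite distrC in H1.
have : N%:R * L0 * `|x - y| = N%:R * L0 * (s * `|x - y|) + N%:R * L0 * ((1 - s) * `|x - y|) by ring.
lra.
Qed.

End MaxLipschitz.

Section Perron.
Context {R : realType} {N : nat}.
Variables (G : 'rV[R]_N -> 'rV[R]_N -> R) (K L0 l : R).
Hypotheses (G_per : Zperiodic G) (G_cont : continuous_hamiltonian G).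
Hypotheses (G_ge0 : forall x p, 0 <= G x p) (G_le : forall x, G x 0 <= K).
Hypotheses (G_coer : forall x p, G x p <= K -> forall i, `|p 0 i| <= L0) (l0 : 0 < l).
Implicit Types (x y p : 'rV[R]_N) (u v phi psi : 'rV[R]_N -> R).

Let F x (r : R) p := l * r + G x p.

(** With the Lipschitz constant fixed in the class, the supremum inherits it. [N * L0] is the
    constant that [max_lipschitz] preserves. *)
Let lip_subsols : set ('rV[R]_N -> R) := [set v | [/\ Zperiodic v,
  forall x y, v x - v y <= N%:R * L0 * `|x - y| & subsol F v]].

Lemma superdiff_cst (c : R) x p : superdiff (cst c) x p -> p = 0.
Proof.
move=> [phi [[_ dphi _] mx <-]]; rewrite -(grad_cst c x); apply/esym/grad_max_eq => //.
Qed.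

Lemma superdiff_at_max u x : (forall y, u y <= u x) -> superdiff u x 0.
Proof.
move=> mx; exists (cst 0); split; [exact: C1_cst|by move=> y; rewrite /= !subr0|exact: grad_cst].
Qed.

Lemma hamiltonian_continuous3 :
  continuous (fun z : 'rV[R]_N * R * 'rV[R]_N => G z.1.1 z.2).
Proof.
pose T := ('rV[R]_N * R * 'rV[R]_N)%type.
have c1 : continuous (fun z : T => z.1.1) by move=> z; exact: (cvg_comp _ _ cvg_fst cvg_fst).
have c2 : continuous (fun z : T => z.2) by move=> z; exact: cvg_snd.
have Gc : continuous (fun y : 'rV[R]_N * 'rV[R]_N => G y.1 y.2) := G_cont.
by move=> z; exact: (continuous_comp (cvg_pair (c1 z) (c2 z)) (Gc _)).
Qed.

Lemma discounted_continuous : continuous (fun z : 'rV[R]_N * R * 'rV[R]_N => F z.1.1 z.1.2 z.2).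
Proof.
pose T := ('rV[R]_N * R * 'rV[R]_N)%type.
have c2 : continuous (fun z : T => z.1.2) by move=> z; exact: (cvg_comp _ _ cvg_fst cvg_snd).
have c3 := hamiltonian_continuous3.
by move=> z; exact: (@cvgD _ _ _ (nbhs z) _ (fun z : T => l * z.1.2) _ _ _ (cvgMl_tmp (c2 z)) (c3 z)).
Qed.

Lemma grad_bound_ge0 (i : 'I_N) : 0 <= L0.
Proof. by have := G_coer (G_le 0) i; rewrite mxE normr0. Qed.

Lemma lip_bound_ge0 : 0 <= N%:R * L0.
Proof. 
(* For [N = 0] the sign of [L0] is undetermined, but the product vanishes. *)
have [n0|n0] := posnP N; first by rewrite n0 mul0r.
by rewrite mulr_ge0// (grad_bound_ge0 (Ordinal n0)).
Qed.

Lemma lip_subsol_cst : lip_subsols (cst (- K / l)).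
Proof.
split=> //; first by move=> x y; rewrite subrr mulr_ge0// lip_bound_ge0.
move=> x p /superdiff_cst ->; rewrite /F /= mulrC divfK ?gt_eqF//.
by have := G_le x; lra.
Qed.

(** At a maximum point of [v], 0 is a supergradient, so [l * v + G y 0 <= 0] there with [G]
    nonnegative. *)
Lemma lip_subsol_le0 v x : lip_subsols v -> v x <= 0.
Proof.
move=> [vp vL vs]; have [y yP] := periodic_max (lip_continuous vL) vp.
apply: le_trans (yP x) _; have := vs _ _ (superdiff_at_max yP).
rewrite /F => H; have H2 := G_ge0 y 0.
by rewrite -(pmulr_rle0 _ l0); lra.
Qed.

Let u x := sup [set v x | v in lip_subsols].

Lemma lip_subsol_has_sup x : has_sup [set v x | v in lip_subsols].
Proof.
split; first by exists (- K / l), (cst (- K / l)) => //; exact: lip_subsol_cst.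
by exists 0 => _ [v vS <-]; exact: lip_subsol_le0.
Qed.

Lemma le_perron v x : lip_subsols v -> v x <= u x.
Proof. by move=> vS; apply: sup_upper_bound; [exact: lip_subsol_has_sup|exists v]. Qed.

Lemma perron_le x c : (forall v, lip_subsols v -> v x <= c) -> u x <= c.
Proof.
move=> H; apply: ge_sup; first by case: (lip_subsol_has_sup x).
by move=> _ [v vS <-]; exact: H.
Qed.

Lemma perron_bound x : - K / l <= u x <= 0.
Proof.
rewrite (le_perron x lip_subsol_cst)/=; apply: perron_le => v; exact: lip_subsol_le0.
Qed.

Lemma perron_per : Zperiodic u.
Proof. by move=> x k; congr sup; apply: eq_imagel => v [vp _ _]; rewrite vp. Qed.

Lemma perron_lip x y : u x - u y <= N%:R * L0 * `|x - y|.
Proof.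
rewrite lerBlDr; apply: perron_le => v vS; have [_ vL _] := vS.
by have := vL x y; have := le_perron y vS; lra.
Qed.

(** A member nearly attaining the supremum at [x0] lies below [u] everywhere, so it is an
    approximant in the sense of [subsol_stable]. *)
Lemma perron_subsol : subsol F u.
Proof.
apply: subsol_stable discounted_continuous _ => x0 e e0.
have [_ [v vS <-] uv] := sup_adherent e0 (lip_subsol_has_sup x0).
have [vp vL vs] := vS; exists v; split => //; first exact: lip_continuous vL.
- by move=> y; have := le_perron y vS; lra.
- exact: ltW.
- by move=> x p /vs; rewrite /F; lra.
Qed.

(* If the supersolution test fails at [x0], lifting the test function slightly there and taking
   the maximum with [u] gives a larger element of [lip_subsols]. *)
Lemma perron_supersol : supersol F u.
Proof.
move=> x0 _ [phi [phi1 mn <-]]; rewrite leNgt; apply/negP => F0.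
(* Subtracting the bump makes the contact strict modulo [Z^N], so that a small lift exceeds [u] only
   near the orbit of [x0]. *)
pose psi0 := phi \+ (-1 \*: cosbump x0).
have psi01 : C1_torus psi0 := C1D phi1 (C1Z (-1) (C1_cosbump x0)).
have [phip dphi _] := phi1.
pose b := u x0 - phi x0.
pose h (z : 'rV[R]_N * R) := F z.1 (psi0 z.1 + b + z.2) (grad psi0 z.1).
have gpsi0 : grad psi0 x0 = grad phi x0.
  rewrite gradD//; last by apply: differentiableZ; exact: cosbump_differentiable.
  rewrite gradZ; last exact: cosbump_differentiable.
  by rewrite grad_cosbump_id scaler0 addr0.
have psi0x0 : psi0 x0 + b = u x0.
  by rewrite /psi0/= /GRing.scale/= cosbump_id /b; ring.
have h0 : h (x0, 0) < 0 by rewrite /h/= gpsi0 psi0x0 addr0.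
have [r r0 rP] : exists2 r, 0 < r & forall z, `|z - (x0, 0)| < r -> h z < 0.
  have hc : continuous h.
    have [_ _ gc] := psi01; have psic := C1_continuous psi01.
    pose T := ('rV[R]_N * R)%type.
    have c1 : continuous (fun z : T => z.1) by move=> z; exact: cvg_fst.
    have c2 : continuous (fun z : T => psi0 z.1 + b + z.2).
      move=> z; apply: (@cvgD _ _ _ (nbhs z) _ (fun z : T => psi0 z.1 + b) (fun z : T => z.2)); last exact: cvg_snd.
      apply: (@cvgD _ _ _ (nbhs z) _ (fun z : T => psi0 z.1) (cst b)); last exact: cvg_cst.
      exact: (continuous_comp (c1 z) (psic _)).
    have c3 : continuous (fun z : T => grad psi0 z.1).
      by move=> z; exact: (continuous_comp (c1 z) (gc _)).
    have gc' : continuous (fun z : T => (z.1, psi0 z.1 + b + z.2, grad psi0 z.1)).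
      by move=> z; exact: (cvg_pair (cvg_pair (c1 z) (c2 z)) (c3 z)).
    have Fc := discounted_continuous.
    by move=> z; exact: (continuous_comp (gc' z) (Fc _)).
  have [|r r0 rP] := continuous_dist_lt (hc (x0, 0)) (e := - h (x0, 0)); first by lra.
  exists r => // z /rP; rewrite ltr_norml => /andP[_]; lra.
have [c c0 cP] := @cosbump_small _ N _ r0.
(* [t < c] confines the set where [u < psi] to [cosbump x0 < c]; [t < r] keeps the lift within the
   range where [h] is negative. *)
pose t := Num.min r c / 2.
have rc0 : 0 < Num.min r c by rewrite lt_min r0.
have t0 : 0 < t by rewrite divr_gt0.
have trc : t < Num.min r c by rewrite /t; lra.
have [tr tc] : t < r /\ t < c by move: trc; rewrite lt_min => /andP.
pose psi := psi0 \+ cst (b + t).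
have psi1 : C1_torus psi := C1D psi01 (C1_cst (b + t)).
have [psip dpsi _] := psi1; have [psi0p dpsi0 _] := psi01.
have gpsi x : grad psi x = grad psi0 x.
  by rewrite gradD// grad_cst addr0.
have sub x : u x < psi x -> F x (psi x) (grad psi x) < 0.
  rewrite /psi/= /psi0/= /GRing.scale/= => H.
  have bc : cosbump x0 x < c by have := mn x; rewrite /b in H; lra.
  have [k kP] := cP _ _ bc.
  have := rP (x + map_mx intr k, t).
  rewrite prod_normE/= gt_max kP subr0 gtr0_norm// tr => /(_ isT).
  rewrite /h/= -gpsi (grad_periodic psip) psi0p /F G_per -addrA.
  by rewrite /psi/= /psi0/= /GRing.scale/=.
pose w x := Num.max (u x) (psi x).
have wS : lip_subsols w.
  split.
  - by move=> x k; rewrite /w perron_per psip.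
  - apply: max_lipschitz => //; first exact: perron_lip.
    (* Where [u < psi], the inequality [F < 0] and [l * psi > l * u >= - K] give [G < K], so
       coercivity bounds the gradient of [psi]. *)
    move=> x ux; apply: (@G_coer x); have := sub x ux; rewrite /F.
    have := perron_bound x => /andP[H _].
    have : - K <= l * u x by rewrite -ler_pdivrMl// mulrC.
    have : l * u x < l * psi x by rewrite ltr_pM2l.
    lra.
  move=> x _ [chi [chi1 mx <-]].
  have [_ dchi _] := chi1.
  (* A function touching [w] from above also touches whichever of [u] and [psi] attains the maximum
     at [x]. *)
  have [ux|ux] := leP (psi x) (u x).
    have wu : w x = u x by rewrite /w max_l.
    rewrite wu; apply: perron_subsol; exists chi; split=> // y.
    apply: le_trans (_ : w y - chi y <= _); last by rewrite -wu mx.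
    by rewrite lerD2r /w le_max lexx.
  have wpsi : w x = psi x by rewrite /w max_r// ltW.
  have -> : grad chi x = grad psi x.
    apply/esym; apply: grad_max_eq => // y.
    apply: le_trans (_ : w y - chi y <= _); last by rewrite -wpsi mx.
    by rewrite lerD2r /w le_max lexx orbT.
  by rewrite wpsi ltW// sub.
have := le_perron x0 wS; rewrite leNgt => /negP; apply.
by rewrite /w lt_max /psi /= addrA psi0x0 ltrDl t0 orbT.
Qed.

(** Neither the Lipschitz constant nor the bound on [l * u] depends on [l], which is what the limit
    [l -> 0] requires. *)
Lemma discounted_solution : exists u : 'rV[R]_N -> R, [/\ Zperiodic u,
  forall x y, u x - u y <= N%:R * L0 * `|x - y|,
  forall x, - K <= l * u x <= 0,
  subsol (fun x r p => l * r + G x p) u &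
  supersol (fun x r p => l * r + G x p) u].
Proof.
exists u; split; [exact: perron_per|exact: perron_lip| |exact: perron_subsol|exact: perron_supersol].
move=> x; have /andP[H1 H2] := perron_bound x.
by rewrite pmulr_rle0// H2 andbT -ler_pdivrMl// mulrC.
Qed.

End Perron.

(** * The cell problem *)

Section UltrafilterLimit.

Lemma ultra_fmap (T U : Type) (f : T -> U) (F : set_system T) :
  UltraFilter F -> UltraFilter (f @ F).
Proof.
move=> FU; split; first exact: fmap_proper_filter.
move=> G GF FG; apply/seteqP; split=> // A GA.
have [//|FnA] := in_ultra_setVsetC (f @^-1` A) FU.
have GnA : G (~` A) by apply: FG.
by have [x [Ax nAx]] := filter_ex (filterI GA GnA).
Qed.

(** Replaces the extraction of subsequences: a single ultrafilter gives limits at all points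
    simultaneously. *)
Lemma ultra_bounded_cvg (R : realType) (T : Type) (F : set_system T) (f : T -> R) (M : R) :
  UltraFilter F -> (forall t, `|f t| <= M) -> exists a : R, f t @[t --> F] --> a.
Proof.
move=> FU fM.
have := @segment_compact R (- M) M; rewrite compact_ultra => /(_ (f @ F)).
case; first exact: ultra_fmap.
  have H : F (f @^-1` `[- M, M]) by apply: filterE => t; rewrite /= in_itv/= -ler_norml.
  exact: H.
by move=> a [_ fa]; exists a.
Qed.

End UltrafilterLimit.

Section CellProblem.
Context {R : realType} {N : nat}.
Variables (G : 'rV[R]_N -> 'rV[R]_N -> R) (K L0 : R).
Hypotheses (G_per : Zperiodic G) (G_cont : continuous_hamiltonian G).
Hypotheses (G_ge0 : forall x p, 0 <= G x p) (G_le : forall x, G x 0 <= K).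
Hypotheses (G_coer : forall x p, G x p <= K -> forall i, `|p 0 i| <= L0).
Implicit Types (x y p : 'rV[R]_N) (u v : 'rV[R]_N -> R).

(* Arzela-Ascoli along an ultrafilter: pointwise limits of equi-Lipschitz functions are
   uniform on compact sets. *)
Lemma equi_lip_uniform (U : set_system nat) (v : nat -> 'rV[R]_N -> R) u (L e : R) : ProperFilter U ->
  (forall n, Zperiodic (v n)) -> (forall n x y, v n x - v n y <= L * `|x - y|) ->
  (forall x, v n x @[n --> U] --> u x) -> 0 < e ->
  [/\ Zperiodic u, forall x y, u x - u y <= L * `|x - y| &
   \forall n \near U, forall x, `|v n x - u x| < e].
Proof.
move=> UF vp vL vu e0.
have up : Zperiodic u.
  move=> x k; have := vu (x + map_mx intr k).
  rewrite (_ : (fun n => _) = v^~ x); last by apply/funext => n; rewrite vp.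
  by move=> H; apply: (cvg_unique _ H (vu x)).
have uL x y : u x - u y <= L * `|x - y|.
  apply: cvgr_to_le (cvgB (vu x) (vu y)) _.
  by apply: nearW => n; exact: vL.
split => //.
have e3 : 0 < e / 3 by rewrite divr_gt0.
have /compact_near_coveringP/(_ _ U (fun n x => `|v n x - u x| < e) _) cov :=
  @unit_cell_compact R N.
have {cov} : \forall n \near U, unit_cell `<=` [set x | `|v n x - u x| < e].
  apply: cov => x _.
  have n1 : \forall n \near U, `|u x - v n x| < e / 3 by exact: (@cvgr_dist_lt _ _ _ U _ _ _ (vu x) _ e3).
  have L0' : 0 < `|L| + 1 by rewrite ltr_wpDl.
  have n2 : \forall y \near x, `|x - y| < e / 3 / (`|L| + 1).
    apply/nbhs_ballP; exists (e / 3 / (`|L| + 1)); first by rewrite /= divr_gt0.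
    by move=> y; rewrite -ball_normE.
  exists ([set y | `|x - y| < e / 3 / (`|L| + 1)], [set n | `|u x - v n x| < e / 3]) => //.
  move=> [y n] /= [xy un].
  have Lxy : L * `|x - y| < e / 3.
    apply: (@le_lt_trans _ _ ((`|L| + 1) * `|x - y|)).
      by rewrite ler_wpM2r// (le_trans (ler_norm _))// lerDl.
    by rewrite mulrC -ltr_pdivlMr.
  have := lip_dist (vL n) x y; have := lip_dist uL x y.
  move: un; rewrite !ltr_norml !ler_norml => /andP[a1 a2] /andP[a3 a4] /andP[a5 a6].
  by apply/andP; split; lra.
apply: filterS => n nP x; have [k xk] := torus_representative x.
by rewrite -(vp n x k) -(up x k); exact: nP.
Qed.

Lemma cell_solution : exists a u, Lip_torus u /\ viscosity_solution (fun x p => G x p - a) u.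
Proof.
pose l n : R := n.+1%:R^-1.
have l0 n : 0 < l n by rewrite invr_gt0.
have /choice[w wP] n := discounted_solution G_per G_cont G_ge0 G_le G_coer (l0 n).
pose L := N%:R * L0.
have L_ge0 : 0 <= L by exact: (lip_bound_ge0 G_le G_coer).
(* [w n] may grow like [K / l n]; after subtracting its value at 0, the Lipschitz bound and
   periodicity bound it uniformly. *)
pose v n x := w n x - w n 0.
have vp n : Zperiodic (v n) by move=> x k; rewrite /v; have [wp _ _ _ _] := wP n; rewrite wp.
have vL n x y : v n x - v n y <= L * `|x - y|.
  by have [_ wL _ _ _] := wP n; rewrite /v opprB addrA subrK; exact: wL.
have vb n x : `|v n x| <= L.
  have [k xk] := torus_representative x; rewrite -(vp n x k).
  have := lip_dist (vL n) (x + map_mx intr k) 0.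
  rewrite {2}/v subrr !subr0 => /le_trans; apply.
  by rewrite ler_piMr// (le_trans xk)// invf_le1// ler1n.
have [U [UU sub]] := @ultraFilterLemma nat \oo _.
have /choice[u uP] x := ultra_bounded_cvg UU (vb^~ x).
have [c cP] : exists c : R, l n * w n 0 @[n --> U] --> c.
  apply: (@ultra_bounded_cvg _ _ _ _ K) => n; have [_ _ wb _ _] := wP n.
  by have /andP[? ?] := wb 0; rewrite ler_norml; apply/andP; split; lra.
have UP : ProperFilter U by exact: ultra_proper.
have [up uL _] := equi_lip_uniform UP vp vL uP ltr01.
have app (e : R) : 0 < e -> exists n, (forall x, `|v n x - u x| < e) /\
    forall x, `|l n * w n x - c| < e.
  move=> e0; have e2 : 0 < e / 2 by rewrite divr_gt0.
  have [_ _ n1] := equi_lip_uniform UP vp vL uP e0.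
  have n2 : \forall n \near U, `|c - l n * w n 0| < e / 2 by exact: (@cvgr_dist_lt _ _ _ U _ _ _ cP _ e2).
  have n3 : \forall n \near U, l n * L < e / 2.
    apply: sub.
    have : l n * L @[n --> \oo] --> 0 * L by apply: cvgMr_tmp; exact: cvg_harmonic.
    by rewrite mul0r => /cvgr_lt; apply.
  have [n [[H1 H2] H3]] := filter_ex (filterI (filterI n1 n2) n3).
  exists n; split=> // x.
  have -> : l n * w n x - c = l n * v n x - (c - l n * w n 0) by rewrite /v; ring.
  rewrite (le_lt_trans (ler_normB _ _))// [ltRHS]splitr ltrD// normrM gtr0_norm//.
  by rewrite (le_lt_trans _ H3)// ler_wpM2l// ltW.
(* Since [l n * v n] tends to 0, [l n * w n] tends uniformly to the constant [c], and the discounted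
   equation becomes [c + G = 0]. *)
exists (- c), u; split; first by split=> //; apply/lipschitzP; exists L.
have Fc : continuous (fun z : 'rV[R]_N * R * 'rV[R]_N => G z.1.1 z.2 + c).
  have Gc := hamiltonian_continuous3 G_cont.
  move=> z; exact: (@cvgD _ _ _ (nbhs z) _ _ (cst c) _ _ (Gc z) (@cvg_cst _ _ _ _ _)).
have sdv n x p : superdiff (v n) x p -> superdiff (w n) x p.
  by move=> [phi [phi1 mx gp]]; exists phi; split=> // y; have := mx y; rewrite /v; lra.
have sbv n x p : subdiff (v n) x p -> subdiff (w n) x p.
  by move=> [phi [phi1 mx gp]]; exists phi; split=> // y; have := mx y; rewrite /v; lra.
split=> x p; rewrite opprK; move: x p.
- apply: (@subsol_stable _ _ (fun x _ p => G x p + c)) => // x0 e e0.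
  have [n [vu lw]] := app e e0; exists (v n); split => //.
  + exact: lip_continuous (vL n).
  + by move=> y; have := vu y; rewrite ltr_norml => /andP[? ?]; lra.
  + by have := vu x0; rewrite ltr_norml => /andP[? ?]; lra.
  + move=> x p /sdv; have [_ _ _ ws _] := wP n; move=> /ws.
    by have := lw x; rewrite ltr_norml => /andP[? ?]; lra.
- apply: (@supersol_stable _ _ (fun x _ p => G x p + c)) => // x0 e e0.
  have [n [vu lw]] := app e e0; exists (v n); split => //.
  + exact: lip_continuous (vL n).
  + by move=> y; have := vu y; rewrite ltr_norml => /andP[? ?]; lra.
  + by have := vu x0; rewrite ltr_norml => /andP[? ?]; lra.
  + move=> x p /sbv; have [_ _ _ _ ws] := wP n; move=> /ws.
    by have := lw x; rewrite ltr_norml => /andP[? ?]; lra.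
Qed.

End CellProblem.

(** * Comparison *)

Section Comparison.
Context {R : realType} {N : nat}.
Implicit Types (x y p : 'rV[R]_N) (u v : 'rV[R]_N -> R).

(* Doubling of variables, penalized by [K * cosbump y x] with [K] large. *)
Lemma comparison (G1 G2 : 'rV[R]_N -> 'rV[R]_N -> R) (a b L d e : R) u v :
  Zperiodic v -> (forall x y, v x - v y <= L * `|x - y|) ->
  continuous u -> Zperiodic u ->
  (forall x p, superdiff v x p -> G1 x p <= a) ->
  (forall x p, subdiff u x p -> b <= G2 x p) ->
  0 < d ->
  (forall x y p, `|x - y| < d -> (forall i, `|p 0 i| <= L) -> G2 y p <= G1 x p + e) ->
  b <= a + e.
Proof.
move=> vp vL uc up vs us d0 G12.
have [c c0 cP] := @cosbump_small _ N _ d0.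
(* Comparing the maximum with the diagonal point [(y, y)] gives
   [K * cosbump y x' <= v x' - v y <= |L|]; this [K] then forces the bump below [c]. *)
pose K := `|L| / c + 1.
have K0 : 0 < K by rewrite ltr_wpDl// divr_ge0// ltW.
pose f (z : 'rV[R]_N * 'rV[R]_N) := v z.1 - u z.2 - K * cosbump 0 (z.1 - z.2).
have bumpE x y : cosbump 0 (x - y) = cosbump y x.
  by apply: eq_bigr => i _; rewrite !mxE subr0.
have fc : continuous f.
  pose T := ('rV[R]_N * 'rV[R]_N)%type.
  have c1 : continuous (fun z : T => z.1) by move=> z; exact: cvg_fst.
  have c2 : continuous (fun z : T => z.2) by move=> z; exact: cvg_snd.
  have vc := lip_continuous vL; have bc := C1_continuous (C1_cosbump (0 : 'rV[R]_N)).
  have c3 : continuous (fun z : T => v z.1) by move=> z; exact: (continuous_comp (c1 z) (vc _)).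
  have c4 : continuous (fun z : T => u z.2) by move=> z; exact: (continuous_comp (c2 z) (uc _)).
  have c5 : continuous (fun z : T => z.1 - z.2).
    by move=> z; exact: (@cvgB _ _ _ (nbhs z) _ _ _ _ _ (c1 z) (c2 z)).
  have c6 : continuous (fun z : T => cosbump 0 (z.1 - z.2)).
    by move=> z; exact: (continuous_comp (c5 z) (bc _)).
  move=> z; apply: (@cvgB _ _ _ (nbhs z) _ (fun z : T => v z.1 - u z.2) (fun z : T => K * cosbump 0 (z.1 - z.2))).
    exact: (@cvgB _ _ _ (nbhs z) _ _ _ _ _ (c3 z) (c4 z)).
  exact: (cvgMl_tmp (c6 z)).
have fp1 y : Zperiodic (fun x => f (x, y)).
  by move=> x k; rewrite /f/= vp [x + _ - y]addrAC (cosbump_periodic _ (x - y)).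
have fp2 x : Zperiodic (fun y => f (x, y)).
  move=> y k; rewrite /f/= up !bumpE !(cosbump_sym _ x); congr (_ - _ * _).
  exact: cosbump_periodic.
have [[x' y] mx] := periodic_max2 fc fp2 fp1.
have [j jP] := torus_representative (x' - y).
have vxy : v x' - v y <= `|L|.
  rewrite -(vp x' j); apply: (le_trans (vL _ _)).
  rewrite addrAC; apply: (@le_trans _ _ (`|L| * `|x' - y + map_mx intr j|)).
    by rewrite ler_wpM2r// ler_norm.
  by rewrite ler_piMr// (le_trans jP)// invf_le1// ler1n.
have Kb : K * cosbump y x' <= `|L|.
  by have := mx (y, y); rewrite /f/= !bumpE cosbump_id; lra.
have bc : cosbump y x' < c.
  rewrite -(ltr_pM2l K0); apply: (le_lt_trans Kb).
  by rewrite /K mulrDl divfK ?gt_eqF// mul1r ltrDl.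
have [k kP] := cP _ _ bc.
(* The maximum point is moved within its orbit to make [x] genuinely close to [y]. *)
pose x := x' + map_mx intr k.
have {}mx z : f z <= f (x, y) by rewrite /x fp1.
have {}kP : `|x - y| < d := kP.
clearbody x.
(* As the sine is odd, the gradients of the penalty in its two variables are opposite. Hence the
   same [p] is a supergradient of [v] and a subgradient of [u], and the Lipschitz bound on [v]
   controls it. *)
pose p := grad (K \*: cosbump y) x.
have vp' : superdiff v x p.
  exists (K \*: cosbump y); split => //; first exact: (C1Z _ (C1_cosbump y)).
  by move=> z; have := mx (z, y); rewrite /f/= !bumpE /GRing.scale/=; lra.
have up' : subdiff u y p.
  exists ((- K) \*: cosbump x); split => //; first exact: (C1Z _ (C1_cosbump x)).
    move=> z; have := mx (x, z); rewrite /f/= !bumpE /GRing.scale/=.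
    by rewrite ![cosbump _ x]cosbump_sym; lra.
  rewrite /p !gradZ; [|exact: cosbump_differentiable..].
  rewrite !grad_cosbump; apply/rowP => i; rewrite !mxE.
  by rewrite -[y 0 i - x 0 i]opprB mulrN sinN mulrN mulrNN.
apply: (le_trans (us _ _ up')); apply: (le_trans (G12 x y p kP _)).
  exact: superdiff_bound vL _ _ vp'.
by rewrite lerD2r vs.
Qed.

End Comparison.

(** * Convergence of the effective Hamiltonians *)

Section ErealLimits.
Context {R : realType} {T : Type}.
Implicit Types (f : nat -> T -> R) (A : set T).

(** Turns the extended-real conditions, in (A4) as in the conclusion, into uniform real inequalities
    for all large [n]. *)
Lemma limn_esup_sup_le0P f A :
  (limn_esup (fun n => ereal_sup [set (f n z)%:E | z in A]) <= 0)%E <->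
  forall e : R, 0 < e -> \forall n \near \oo, forall z, A z -> f n z <= e.
Proof.
split=> [H e e0|H].
  have /ereal_inf_lt : (limn_esup (fun n => ereal_sup [set (f n z)%:E | z in A]) < e%:E)%E.
    by apply: le_lt_trans H _; rewrite lte_fin.
  move=> [_ [V Voo <-]] Ve; apply: filterS Voo => n Vn z Az.
  rewrite -lee_fin (le_trans _ (ltW Ve))//.
  apply: (@le_trans _ _ (ereal_sup [set (f n z)%:E | z in A])).
    by apply: ereal_sup_ubound; exists z.
  by apply: ereal_sup_ubound; exists n.
apply/lee_addgt0Pr => e e0; rewrite add0e.
(* The upper limit is an infimum over the sets belonging to [\oo]; the set of good indices is one of
   them. *)
apply: (@le_trans _ _ (ereal_sup ((fun n => ereal_sup [set (f n z)%:E | z in A])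
    @` [set n | forall z, A z -> f n z <= e]))).
  apply: ereal_inf_lbound.
  by exists [set n | forall z, A z -> f n z <= e] => //; exact: H.
by apply: ge_ereal_sup => _ [n /= nP <-]; apply: ge_ereal_sup => _ [z Az <-]; rewrite lee_fin nP.
Qed.

Lemma limn_einf_inf_ge0P f A :
  (0 <= limn_einf (fun n => ereal_inf [set (f n z)%:E | z in A]))%E <->
  forall e : R, 0 < e -> \forall n \near \oo, forall z, A z -> - e <= f n z.
Proof.
rewrite /limn_einf oppe_ge0.
rewrite (_ : limn_esup _ = limn_esup (fun n => ereal_sup [set (- f n z)%:E | z in A])); last first.
  congr limn_esup; apply/funext => n /=; rewrite ereal_infEN oppeK; congr ereal_sup.
  by rewrite image_comp; apply: eq_imagel => z _ /=; rewrite EFinN.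
rewrite limn_esup_sup_le0P; split => H e e0; have := H e e0.
  by apply: filterS => n nP z /nP; rewrite lerNl.
by apply: filterS => n nP z /nP; rewrite lerNl.
Qed.

End ErealLimits.

(** * Upper and lower estimates through the critical value *)

Section CriticalValue.
Context {R : realType} {N : nat}.
Variables (H : 'rV[R]_N -> 'rV[R]_N -> R) (M C : R).
Hypotheses (H_ge0 : forall x p, 0 <= H x p) (H_le : forall x p, H x p <= M).
Hypothesis H_lip : forall x p q, H x p <= H x q + C * enorm (p - q).
Hypothesis H_unif : forall e, 0 < e -> exists2 d, 0 < d &
  forall x y p, `|x - y| < d -> H y p <= H x p + e.
Implicit Types (x y p P Q : 'rV[R]_N) (u v : 'rV[R]_N -> R).

Definition sublevel P : set R := [set a | exists v, Lip_torus v /\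
  forall x p, superdiff v x p -> H x (p + P) <= a].

Definition critical_value P := inf (sublevel P).

Lemma sublevel_ge0 P a : sublevel P a -> 0 <= a.
Proof.
move=> [v [[vp /lipschitzP[L L0 vL]] vs]].
have [y yP] := periodic_max (lip_continuous vL) vp.
exact: le_trans (H_ge0 _ _) (vs _ _ (superdiff_at_max yP)).
Qed.

(** Makes [inf] a genuine infimum: constant functions have level [M], and all levels are
    nonnegative. *)
Lemma sublevel_has_inf P : has_inf (sublevel P).
Proof.
split; last by exists 0 => a; exact: sublevel_ge0.
exists M, (cst 0); split; last by move=> x p _; exact: H_le.
by split=> //; apply/lipschitzP; exists 0 => // x y; rewrite subrr mul0r.
Qed.

Lemma critical_value_le P a : sublevel P a -> critical_value P <= a.
Proof. by move=> Pa; apply: ge_inf => //; case: (sublevel_has_inf P). Qed.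

Lemma critical_value_adherent P e : 0 < e ->
  exists2 a, sublevel P a & a < critical_value P + e.
Proof. by move=> e0; exact: inf_adherent e0 (sublevel_has_inf P). Qed.

(** A subsolution for [Q] serves for [P] as well, at the cost of the Lipschitz bound of [H] in
    [p]. *)
Lemma critical_value_lip P Q : critical_value P <= critical_value Q + C * enorm (P - Q).
Proof.
apply/ler_addgt0Pr => e e0; have [a [v [vl vs]] ae] := critical_value_adherent Q e0.
apply: (@le_trans _ _ (a + C * enorm (P - Q))); last by lra.
apply: critical_value_le; exists v; split=> // x p /vs H1.
have := H_lip x (p + P) (p + Q).
by rewrite opprD addrACA subrr add0r; lra.
Qed.

Variables (Hn : nat -> 'rV[R]_N -> 'rV[R]_N -> R) (Hbar : nat -> 'rV[R]_N -> R).
Hypothesis Hbar_eff : forall n, effective_hamiltonian (Hn n) (Hbar n).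

Lemma critical_value_upper e :
  (\forall n \near \oo, forall x p, H x p <= Hn n x p + e) ->
  \forall n \near \oo, forall P, critical_value P <= Hbar n P + e.
Proof.
apply: filterS => n HnP P.
have [u [ul [us _]]] := Hbar_eff n P.
apply: critical_value_le; exists u; split => // x p /us.
by have := HnP x (p + P); lra.
Qed.

Lemma critical_value_lower r e : 0 < r -> 0 < e ->
  (forall s d, 0 < s -> 0 < d ->
     \forall n \near \oo, forall x p, enorm p <= s -> Hn n x p <= H x p + d) ->
  \forall n \near \oo, forall P, enorm P <= r -> Hbar n P <= critical_value P + e.
Proof.
move=> r0 e0 Hnle.
(* The threshold for [n] found near [P0] depends on the subsolution chosen there, so uniformity
   comes from covering a compact sup-norm ball, which contains the Euclidean one. *)
have /compact_near_coveringP/(_ _ \oo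
  (fun n P => enorm P <= r -> Hbar n P <= critical_value P + e) _) cov :=
  @closed_norm_ball_compact R N r.
have {cov} : \forall n \near \oo, [set P | `|P| <= r] `<=`
    [set P | enorm P <= r -> Hbar n P <= critical_value P + e].
  apply: cov => P0 _.
  (* Five errors: near optimality of [a], moving [P0] to [P] in the equation and again in the
     critical value, continuity of [H] in [x], and (A3). *)
  have e5 : 0 < e / 5 by rewrite divr_gt0.
  have [a [v [[vp /lipschitzP[L L0 vL]] vs]] ae] := critical_value_adherent P0 e5.
  have [d d0 dP] := H_unif e5.
  (* Supergradients of [v] have coordinates at most [L], so [p + P] has Euclidean norm at most
     [N * L + r]. *)
  have s0 : 0 < N%:R * L + r by rewrite ltr_wpDl// mulr_ge0.
  have n1 := Hnle _ _ s0 e5.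
  (* Chosen so that [C * enorm (P - P0) <= e / 5]; [N.+1] bounds the ratio of the two norms and is
     never 0. *)
  pose rho := e / 5 / (`|C| + 1) / N.+1%:R.
  have C0 : 0 < `|C| + 1 by rewrite ltr_wpDl.
  have rho0 : 0 < rho by rewrite !divr_gt0.
  have n2 : \forall P \near P0, `|P0 - P| < rho.
    by apply/nbhs_ballP; exists rho => //= P; rewrite -ball_normE.
  exists ([set P | `|P0 - P| < rho],
    [set n | forall x p, enorm p <= N%:R * L + r -> Hn n x p <= H x p + e / 5]) => //.
  move=> [P n] /= [PP0 nP] Pr.
  have CP : C * enorm (P - P0) <= e / 5.
    apply: (@le_trans _ _ ((`|C| + 1) * enorm (P - P0))).
      by rewrite ler_wpM2r ?enorm_ge0// (le_trans (ler_norm _))// lerDl.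
    rewrite -ler_pdivlMl//; apply: le_trans (enorm_le_norm _) _.
    apply: (@le_trans _ _ (N.+1%:R * rho)).
      by rewrite ler_pM// ?ler_nat// distrC ltW.
    by rewrite /rho mulrCA divff ?mulr1 1?mulrC// pnatr_eq0.
  have := critical_value_lip P0 P; rewrite -enormN opprB => P0P.
  have [u [ul [_ us]]] := Hbar_eff n P.
  have [up /lipschitzP[Lu Lu0 uL]] := ul.
  have : Hbar n P <= a + e / 5 + (e / 5 + e / 5).
    apply: (comparison (G1 := fun x p => H x (p + P)) (G2 := fun x p => Hn n x (p + P))
      vp vL (lip_continuous uL) up _ _ d0) => [x p /vs H1|x p /us|x y p xyd pL].
    - have := H_lip x (p + P) (p + P0).
      by rewrite opprD addrACA subrr add0r; lra.
    - by rewrite subr_ge0.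
    - have H1 := dP x y (p + P) xyd.
      suff : enorm (p + P) <= N%:R * L + r by move=> /(nP y); lra.
      by apply: le_trans (enormD _ _) _; rewrite lerD// enorm_le_coord.
  lra.
apply: filterS => n nP P Pr; apply: nP => //.
by apply: le_trans Pr; apply: mx_norm_le => [|i]; [exact: enorm_ge0|exact: coord_enorm].
Qed.

End CriticalValue.

(** * An admissible sequence that has effective Hamiltonians *)

Section ApproximatingSequence.
Context {R : realType} {N : nat}.
Variables (H : 'rV[R]_N -> 'rV[R]_N -> R) (M : R).
Hypotheses (H_per : Zperiodic H) (H_cont : continuous_hamiltonian H).
Hypotheses (H_ge0 : forall x p, 0 <= H x p) (H_le : forall x p, H x p <= M).
Implicit Types (x y p P : 'rV[R]_N).

Definition linear_perturbation (n : nat) x p := H x p + n.+1%:R^-1 * enorm p.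

Lemma enorm_continuous : continuous (@enorm R N).
Proof.
apply: (dist_continuous (L := N%:R)) => p q.
exact: le_trans (ler_enorm_dist _ _) (enorm_le_norm _).
Qed.

Lemma linear_perturbation_per n : Zperiodic (linear_perturbation n).
Proof. by move=> x k; rewrite /linear_perturbation H_per. Qed.

Lemma linear_perturbation_continuous n : continuous_hamiltonian (linear_perturbation n).
Proof.
pose T := ('rV[R]_N * 'rV[R]_N)%type.
have c2 : continuous (fun z : T => z.2) by move=> z; exact: cvg_snd.
have c3 : continuous (fun z : T => enorm z.2).
  by move=> z; exact: (continuous_comp (c2 z) (@enorm_continuous _)).
have Hc : continuous (fun z : T => H z.1 z.2) := H_cont.
by move=> z; exact: (@cvgD _ _ _ (nbhs z) _ _ _ _ _ (Hc z) (cvgMl_tmp (c3 z))).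
Qed.

Lemma enorm_le_linear_perturbation n x p : enorm p <= n.+1%:R * linear_perturbation n x p.
Proof.
rewrite /linear_perturbation mulrDr mulrA divff ?pnatr_eq0// mul1r lerDr.
by rewrite mulr_ge0.
Qed.

Lemma linear_perturbation_coercive n : coercive (linear_perturbation n).
Proof.
apply/cvgeyPge => A; near=> r.
apply: le_ereal_inf_tmp => _ [z /= rz <-]; rewrite lee_fin.
rewrite -(@ler_pM2l _ n.+1%:R)//; apply: le_trans (enorm_le_linear_perturbation n z.1 z.2).
apply: le_trans rz; near: r; apply: nbhs_pinfty_ge; exact: num_real.
Unshelve. all: by end_near. Qed.

Lemma linear_perturbation_admissible : admissible H linear_perturbation.
Proof.
split.
- by move=> n; split; [exact: linear_perturbation_per|exact: linear_perturbation_continuous].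
- exact: linear_perturbation_coercive.
- move=> r r0; apply/(limn_einf_inf_ge0P (fun n z => H z.1 z.2 - linear_perturbation n z.1 z.2)) => e e0.
  have : n.+1%:R^-1 * r @[n --> \oo] --> 0 * r by apply: cvgMr_tmp; exact: cvg_harmonic.
  rewrite mul0r => /cvgr_lt/(_ _ e0); apply: filterS => n /= ne z /= zr.
  rewrite /linear_perturbation opprD addrA subrr sub0r lerN2 (le_trans _ (ltW ne))//.
  by rewrite ler_wpM2l.
- apply/(limn_esup_sup_le0P (fun n z => H z.1 z.2 - linear_perturbation n z.1 z.2)) => e e0.
  apply: nearW => n z _.
  rewrite /linear_perturbation opprD addrA subrr sub0r (le_trans _ (ltW e0))//.
  by rewrite oppr_le0 mulr_ge0 ?enorm_ge0.
Qed.

Lemma linear_perturbation_effective n P : exists a u, Lip_torus u /\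
  viscosity_solution (fun x p => linear_perturbation n x (p + P) - a) u.
Proof.
(* The first constant bounds the shifted Hamiltonian at [p = 0]. On that sublevel [enorm (p + P)] is
   at most [n + 1] times it, whence the second constant after adding [enorm P]. *)
apply: (@cell_solution _ _ (fun x p => linear_perturbation n x (p + P)) (M + n.+1%:R^-1 * enorm P)
   (n.+1%:R * (M + n.+1%:R^-1 * enorm P) + enorm P)).
- by move=> x k; rewrite linear_perturbation_per.
- pose T := ('rV[R]_N * 'rV[R]_N)%type.
  have c1 : continuous (fun z : T => z.1) by move=> z; exact: cvg_fst.
  have c2 : continuous (fun z : T => z.2 + P).
    move=> z; apply: (@cvgD _ _ _ (nbhs z) _ (fun z : T => z.2) (cst P)); first exact: cvg_snd.
    exact: cvg_cst.
  have Hc : continuous (fun z : T => linear_perturbation n z.1 z.2) := @linear_perturbation_continuous n.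
  by move=> z; exact: (continuous_comp (cvg_pair (c1 z) (c2 z)) (Hc _)).
- by move=> x p; rewrite addr_ge0// mulr_ge0// enorm_ge0.
- by move=> x; rewrite add0r lerD2r.
- move=> x p pK i; apply: le_trans (coord_enorm _ _) _.
  have := enormD (p + P) (- P); rewrite addrK enormN => /le_trans; apply.
  rewrite lerD2r (le_trans (enorm_le_linear_perturbation n x _))//.
  by rewrite ler_wpM2l.
Qed.

End ApproximatingSequence.

(** * Existence and uniqueness of the limit *)

Theorem theorem3p1 (R : realType) (N : nat) (hN : (0 < N)%N)
    (sigma : 'rV[R]_N -> R) (m : R -> R)
    (sigma_per : Zperiodic sigma)
    (sigma_cont : continuous sigma)
    (sigma_gt0 : forall x, 0 < sigma x)
    (m_range : forall r, 0 <= r -> 0 < m r < 1)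
    (m_lip : [lipschitz m r | r in [set r : R | 0 <= r]])
    (m_incr : forall r s, 0 <= r -> r < s -> m r < m s)
    (m_lim : m r @[r --> +oo%R] --> (1 : R)) :
  exists! Hinf : 'rV[R]_N -> R,
    forall (Hn : nat -> 'rV[R]_N -> 'rV[R]_N -> R)
           (Hbar : nat -> 'rV[R]_N -> R),
      admissible (fun x p => sigma x * m (enorm p)) Hn ->
      (forall n, effective_hamiltonian (Hn n) (Hbar n)) ->
      (forall r : R, 0 < r ->
         (0 <= limn_einf (fun n => ereal_inf
            [set (Hinf P - Hbar n P)%R%:E | P in [set P | (enorm P <= r)%R]]))%E) /\
      (limn_esup (fun n => ereal_sup
         [set (Hinf P - Hbar n P)%R%:E | P in setT]) <= 0)%E.
Proof.
pose H (x p : 'rV[R]_N) := sigma x * m (enorm p).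
have m01 (p : 'rV[R]_N) : 0 < m (enorm p) < 1 by apply: m_range; exact: enorm_ge0.
have [xM sigma_max] := periodic_max sigma_cont sigma_per.
pose M := sigma xM.
have M0 : 0 < M := sigma_gt0 xM.
have [L L0 mL] : exists2 L, 0 <= L &
    forall p q : 'rV[R]_N, `|m (enorm p) - m (enorm q)| <= L * enorm (p - q).
  have [K [_ KP]] := m_lip; exists (`|K| + 1) => [|p q]; first by rewrite addr_ge0.
  apply: (@le_trans _ _ ((`|K| + 1) * `|enorm p - enorm q|)).
    apply: (KP (`|K| + 1) _ (enorm p, enorm q)); last by split; exact: enorm_ge0.
    by rewrite (le_lt_trans (ler_norm _))// ltrDl.
  by rewrite ler_wpM2l ?ler_enorm_dist// addr_ge0.
have H_ge0 x p : 0 <= H x p by have /andP[? _] := m01 p; rewrite mulr_ge0// ltW.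
have H_le x p : H x p <= M.
  have /andP[? ?] := m01 p; apply: le_trans (sigma_max x).
  by rewrite ler_piMr// ltW.
have H_per : Zperiodic H by move=> x k; rewrite /H sigma_per.
have H_lip x p q : H x p <= H x q + M * L * enorm (p - q).
  rewrite -lerBlDl -mulrBr; apply: le_trans (ler_norm _) _.
  rewrite normrM gtr0_norm// -mulrA; apply: ler_pM => //; first exact: ltW.
have H_cont : continuous_hamiltonian H.
  pose T := ('rV[R]_N * 'rV[R]_N)%type.
  have c1 : continuous (fun z : T => z.1) by move=> z; exact: cvg_fst.
  have c2 : continuous (fun z : T => z.2) by move=> z; exact: cvg_snd.
  have mc : continuous (fun p : 'rV[R]_N => m (enorm p)).
    apply: (dist_continuous (L := L * N%:R)) => p q; apply: le_trans (mL p q) _.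
    by rewrite -mulrA ler_wpM2l// enorm_le_norm.
  have c3 : continuous (fun z : T => sigma z.1) by move=> z; exact: (continuous_comp (c1 z) (sigma_cont _)).
  have c4 : continuous (fun z : T => m (enorm z.2)) by move=> z; exact: (continuous_comp (c2 z) (mc _)).
  by move=> z; exact: (cvgM (c3 z) (c4 z)).
have H_unif e : 0 < e -> exists2 d, 0 < d & forall x y p, `|x - y| < d -> H y p <= H x p + e.
  move=> e0; have [d d0 dP] := periodic_unif_continuous sigma_cont sigma_per e0.
  exists d => // x y p /dP xy; have /andP[m0 m1] := m01 p.
  rewrite -lerBlDl -mulrBl; apply: le_trans (ler_norm _) _.
  rewrite normrM (gtr0_norm m0) distrC -[leRHS]mulr1.
  by apply: ler_pM => //; exact: ltW.
have Hinf_lim Hn Hbar : admissible H Hn -> (forall n, effective_hamiltonian (Hn n) (Hbar n)) ->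
    (forall r e : R, 0 < r -> 0 < e ->
      \forall n \near \oo, forall P, enorm P <= r -> - e <= critical_value H P - Hbar n P) /\
    (forall e : R, 0 < e -> \forall n \near \oo, forall P, critical_value H P - Hbar n P <= e).
  move=> [_ _ A3 A4] eff; split=> [r e r0 e0|e e0].
    have Hnle s d : 0 < s -> 0 < d ->
        \forall n \near \oo, forall x p, enorm p <= s -> Hn n x p <= H x p + d.
      move=> s0 d0; have /(limn_einf_inf_ge0P (fun n z => H z.1 z.2 - Hn n z.1 z.2))/(_ d d0) := A3 s s0.
      by apply: filterS => n nP x p ps; have := nP (x, p) ps; rewrite /=; lra.
    have := critical_value_lower H_ge0 H_le H_lip H_unif eff r0 e0 Hnle.
    by apply: filterS => n nP P /nP; lra.
  have /(limn_esup_sup_le0P (fun n z => H z.1 z.2 - Hn n z.1 z.2))/(_ e e0) A4e := A4.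
  have HnP : \forall n \near \oo, forall x p, H x p <= Hn n x p + e.
    by apply: filterS A4e => n nP x p; have := nP (x, p) Logic.I; rewrite /=; lra.
  have := critical_value_upper H_ge0 H_le eff HnP.
  by apply: filterS => n nP P; have := nP P; lra.
exists (critical_value H); split.
  move=> Hn Hbar adm eff; have [lo up] := Hinf_lim _ _ adm eff; split.
    move=> r r0; apply/(limn_einf_inf_ge0P (fun n P => critical_value H P - Hbar n P)) => e.
    exact: lo.
  apply/(limn_esup_sup_le0P (fun n P => critical_value H P - Hbar n P)) => e e0.
  by apply: filterS (up e e0) => n nP P _; exact: nP.
move=> Hinf HinfP.
(* Uniqueness: choice over pairs [(n, P)] gives one admissible sequence with effective Hamiltonians,
   against which any two candidates are compared. *)
have /choice[f fP] (nP : nat * 'rV[R]_N) := linear_perturbation_effective H_per H_cont H_ge0 H_le nP.1 nP.2.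
pose Hbar n P := f (n, P).
have eff n : effective_hamiltonian (linear_perturbation H n) (Hbar n) by move=> P; exact: fP (n, P).
have adm := linear_perturbation_admissible H_per H_cont H_ge0.
have [lo up] := Hinf_lim _ _ adm eff; have [lo' up'] := HinfP _ _ adm eff.
apply/funext => P.
have r0 : 0 < enorm P + 1 by rewrite ltr_wpDl// enorm_ge0.
have Pr : enorm P <= enorm P + 1 by rewrite lerDl.
(* For one common large [n], both values at [P] are within [e / 2] of [Hbar n P]. *)
have near_eq e : 0 < e -> `|critical_value H P - Hinf P| <= e.
  move=> e0; have e2 : 0 < e / 2 by rewrite divr_gt0.
  have /(limn_einf_inf_ge0P (fun n P => Hinf P - Hbar n P))/(_ _ e2) n1 := lo' _ r0.
  have /(limn_esup_sup_le0P (fun n P => Hinf P - Hbar n P))/(_ _ e2) n2 := up'.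
  have [n [[[H1 H2] H3] H4]] := filter_ex (filterI (filterI (filterI n1 n2) (lo _ _ r0 e2)) (up _ e2)).
  have {}H1 := H1 P Pr; have {}H2 := H2 P Logic.I; have {}H3 := H3 P Pr; have {}H4 := H4 P.
  by rewrite ler_norml; apply/andP; split; lra.
apply/eqP; rewrite -subr_eq0 -normr_le0.
by apply/ler_addgt0Pr => e e0; rewrite add0r near_eq.
Qed.
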